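(* Let $\alpha>1$ and $\beta>0$. If $1/\beta\in\mathbb N$ or $\beta\in(0,\infty)\setminus\mathbb Q$, then $\mathbb Z$ is definable in $\bigl(\overline{\mathbb R},\,(xF_\alpha'/F_\alpha)',\,(xW_\beta'/W_\beta)'\bigr)$, where $(xF_\alpha'/F_\alpha)'$ and $(xW_\beta'/W_\beta)'$ are regarded as functions on $(0,\infty)$.
   Context: $\overline{\mathbb R}=(\mathbb R,+,\cdot,(r)_{r\in\mathbb R})$ is the real field with a constant for each real number. Definable means first-order definable (parameters from $\mathbb R$ allowed), functions being identified with their graphs; the expansion is obtained by adding the two listed functions as primitives. $\mathbb N$ is the set of nonnegative integers. For $\alpha>1$, $F_\alpha(x)=\prod_{n>0}(1+\alpha^{-n}x)$. For $\beta>0$, $W_\beta$ is the canonical Weierstrass product for the sequence $(-n^\beta)_{n>0}$: $$W_\beta(x)=\prod_{n>0}\left(1+\frac{x}{n^\beta}\right)\exp\left(\sum_{j=1}^{\lfloor 1/\beta\rfloor}\frac{(-1)^jx^j}{jn^{\beta j}}\right).$$ Both are positive on $(0,\infty)$. For $G=F_\alpha$ or $G=W_\beta$, $(xG'/G)'$ is the function $x\mapsto\frac{d}{dx}\bigl(xG'(x)/G(x)\bigr)$. *)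

(* Defs.v *)
From Stdlib Require Import Reals QArith Qreals.
From Coquelicot Require Import Coquelicot.
Open Scope R_scope.

(** * First-order definability in expansions of the real field *)

Inductive term : Type :=
| Var (n : nat)
| Cst (r : R)
| Add (t u : term)
| Mul (t u : term).

(** [Rel i t u] is an atom for the [i]-th added primitive.  The primitives are
    binary relations, so that a partial function of one variable can be added
    through its graph. *)
Inductive formula (I : Type) : Type :=
| Equ (t u : term)
| Rel (i : I) (t u : term)
| Not (phi : formula I)
| And (phi psi : formula I)
| Or (phi psi : formula I)
| Imp (phi psi : formula I)
| Ex (n : nat) (phi : formula I)
| All (n : nat) (phi : formula I).

Arguments Equ {I} t u.
Arguments Rel {I} i t u.
Arguments Not {I} phi.
Arguments And {I} phi psi.
Arguments Or {I} phi psi.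
Arguments Imp {I} phi psi.
Arguments Ex {I} n phi.
Arguments All {I} n phi.

Fixpoint eval (e : nat -> R) (t : term) : R :=
  match t with
  | Var n => e n
  | Cst r => r
  | Add t u => eval e t + eval e u
  | Mul t u => eval e t * eval e u
  end.

Definition update (e : nat -> R) (n : nat) (x : R) : nat -> R :=
  fun m => if Nat.eqb m n then x else e m.

Fixpoint holds {I : Type} (S : I -> R -> R -> Prop) (e : nat -> R)
    (phi : formula I) : Prop :=
  match phi with
  | Equ t u => eval e t = eval e u
  | Rel i t u => S i (eval e t) (eval e u)
  | Not phi => ~ holds S e phi
  | And phi psi => holds S e phi /\ holds S e psi
  | Or phi psi => holds S e phi \/ holds S e psi
  | Imp phi psi => holds S e phi -> holds S e psi
  | Ex n phi => exists x : R, holds S (update e n x) phi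
  | All n phi => forall x : R, holds S (update e n x) phi
  end.

(** Definability of a subset of the line in the expansion of the real field by
    the relations [S]; parameters enter through [Cst]. *)
Definition definable {I : Type} (S : I -> R -> R -> Prop) (A : R -> Prop) : Prop :=
  exists phi : formula I, forall e : nat -> R, holds S e phi <-> A (e 0%nat).

Definition graph_pos (f : R -> R) (x y : R) : Prop := 0 < x /\ y = f x.

Definition pair_rel (P Q : R -> R -> Prop) (b : bool) : R -> R -> Prop :=
  if b then P else Q.

Definition is_integer (x : R) : Prop := exists k : Z, x = IZR k.

(** * The functions *)

(** The product of [a n] over [n > 0].  As [Lim_seq] is total, this is a junk
    value when the partial products have no finite limit. *)
Definition inf_prod (a : nat -> R) : R :=
  real (Lim_seq (fun N => prod_f_R0 (fun n => a (S n)) N)).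

Definition F (alpha x : R) : R := inf_prod (fun n => 1 + / alpha ^ n * x).

(** [Int_part] is the floor function. *)
Definition W (beta x : R) : R :=
  inf_prod (fun n =>
    (1 + x / Rpower (INR n) beta) *
    exp (sum_n_m
           (fun j => (-1) ^ j * x ^ j / (INR j * Rpower (INR n) (beta * INR j)))
           1 (Z.to_nat (Int_part (1 / beta))))).

(** [(x G' / G)'] *)
Definition d_xlogder (G : R -> R) (x : R) : R :=
  Derive (fun t => t * Derive G t / G t) x.

(* Main.v *)
Require Import Defs.
From Stdlib Require Import Reals QArith Qreals.
From Coquelicot Require Import Coquelicot.
From Stdlib Require Import ZArith Lra Lia FunctionalExtensionality ClassicalEpsilon.
Import Defs.
Open Scope R_scope.

(** Write [f] and [g] for the two primitives. For [x > 0] both [x f x] and, up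
    to sign, [x g x] are sums of [kern p (x / a_n)] over the zeros [- a_n] of the
    product.

    Up to an error tending to [0], [x f x] is a nonconstant function invariant
    under [x -> alpha x], so the [c > 0] with [c x f (c x) - x f x -> 0] form a
    definable group [a^Z], [a > 1]. Nonconstancy is a moment argument: constancy
    would give an atomic measure on [(0, 1)] the moments of a multiple of
    Lebesgue measure.

    If [1 / beta = k] is an integer, [x g x / x^k] grows like a nonzero multiple
    of [ln x], and this logarithm maps [a^Z] onto a multiple of [Z]. If
    [beta] is irrational, [x g x] is asymptotic to a multiple of [x^rho],
    [rho = 1 / beta], so [y -> y^rho] is definable, and reducing [a^(n rho)]
    modulo [a^Z] gives a definable dense sequence in [(1, a)] indexed by [a^N].
    With such a sequence, two real parameters built by nested intervals suffice
    to code a set asymptotic to the integers: the first picks a sparse set of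
    indices, and the position of the second among the points of index up to the
    [k]-th of these is near [1 / (k + 2)]. *)

(** * Definable relations *)

(** Multiplying by [x] makes every summand a function of [x / a_n] alone, so dilating [x] compares
    directly with moving the zeros. For [1 / beta = k] the summands with small [n] are close to a
    multiple of [x^k / n], a harmonic sum, whence the logarithm. Otherwise a pure power remains, and
    its residues modulo [a^Z] are dense because of irrationality; a rational non-integer [1 / beta]
    would give neither.

    In the irrational case [a^n] is definable, but the real number [n] is not yet. Integers are
    therefore manufactured as inverses of relative positions on the line. The nested intervals have
    to stay open to leave room for later choices, so the positions are only approximate; the errors
    shrink, and the exact integers are the shifts carrying the far part of the coded set
    approximately into itself.

    For the nonconstancy, [theta (1 + s) / (1 + s)] is the integral of [1 / (1 + s y)^2] against an
    atomic measure. If [theta] were constant, a multiple of Lebesgue measure would have the same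
    integrals; the atom at [1 / 2] is then detected by the weights [(y (1 - y))^N], which peak
    there. *)

Fixpoint vars_below (b : nat) (t : term) : Prop :=
  match t with
  | Var n => (n < b)%nat
  | Cst _ => True
  | Add t u | Mul t u => vars_below b t /\ vars_below b u
  end.

Lemma eval_update_fresh b t e x :
  vars_below b t -> eval (update e b x) t = eval e t.
Proof.
  induction t as [n|r|t IHt u IHu|t IHt u IHu]; simpl; intros H.
  - unfold update. destruct (Nat.eqb_spec n b); [lia|easy].
  - easy.
  - now rewrite IHt, IHu.
  - now rewrite IHt, IHu.
Qed.

Lemma vars_below_le b c t : (b <= c)%nat -> vars_below b t -> vars_below c t.
Proof.
  intros Hbc; induction t; simpl; intuition lia.
Qed.

Fixpoint subst (ts : nat -> term) (t : term) : term :=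
  match t with
  | Var n => ts n
  | Cst r => Cst r
  | Add t u => Add (subst ts t) (subst ts u)
  | Mul t u => Mul (subst ts t) (subst ts u)
  end.

Lemma eval_subst ts t e :
  eval e (subst ts t) = eval (fun i => eval e (ts i)) t.
Proof. induction t; simpl; congruence. Qed.

Definition scons (x : R) (e : nat -> R) : nat -> R :=
  fun i => match i with O => x | S i => e i end.

Section Definability.
Context {I : Type} (M : I -> R -> R -> Prop).

(* Closure under substitution of terms is built in, so that quantifiers can be
   handled in de Bruijn style although [formula] has named variables. *)
Definition dfn (Q : (nat -> R) -> Prop) : Prop :=
  forall (ts : nat -> term) (b : nat), (forall i, vars_below b (ts i)) ->
  exists phi : formula I,
    forall e, holds M e phi <-> Q (fun i => eval e (ts i)).

Definition dfn_fun (tau : (nat -> R) -> R) : Prop :=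
  dfn (fun e => e O = tau (fun i => e (S i))).

Lemma dfn_ext (P Q : (nat -> R) -> Prop) :
  (forall e, P e <-> Q e) -> dfn P -> dfn Q.
Proof.
  intros H HP ts b Hb. destruct (HP ts b Hb) as [phi Hphi].
  exists phi; intros e. rewrite Hphi. apply H.
Qed.

Lemma dfn_and P Q : dfn P -> dfn Q -> dfn (fun e => P e /\ Q e).
Proof.
  intros HP HQ ts b Hb.
  destruct (HP ts b Hb) as [phi Hphi], (HQ ts b Hb) as [psi Hpsi].
  exists (And phi psi); intros e; simpl. now rewrite Hphi, Hpsi.
Qed.

Lemma dfn_or P Q : dfn P -> dfn Q -> dfn (fun e => P e \/ Q e).
Proof.
  intros HP HQ ts b Hb.
  destruct (HP ts b Hb) as [phi Hphi], (HQ ts b Hb) as [psi Hpsi].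
  exists (Or phi psi); intros e; simpl. now rewrite Hphi, Hpsi.
Qed.

Lemma dfn_imp P Q : dfn P -> dfn Q -> dfn (fun e => P e -> Q e).
Proof.
  intros HP HQ ts b Hb.
  destruct (HP ts b Hb) as [phi Hphi], (HQ ts b Hb) as [psi Hpsi].
  exists (Imp phi psi); intros e; simpl. now rewrite Hphi, Hpsi.
Qed.

Lemma dfn_not P : dfn P -> dfn (fun e => ~ P e).
Proof.
  intros HP ts b Hb. destruct (HP ts b Hb) as [phi Hphi].
  exists (Not phi); intros e; simpl. now rewrite Hphi.
Qed.

Lemma scons_terms_below b ts :
  (forall i, vars_below b (ts i)) ->
  forall i, vars_below (S b)
    (match i with O => Var b | S i => ts i end).
Proof.
  intros Hb [|i]; simpl; [lia|].
  apply (vars_below_le b); [lia|apply Hb].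
Qed.

Lemma eval_scons_terms b ts e x :
  (forall i, vars_below b (ts i)) ->
  (fun i => eval (update e b x) (match i with O => Var b | S i => ts i end))
  = scons x (fun i => eval e (ts i)).
Proof.
  intros Hb. apply functional_extensionality; intros [|i]; simpl.
  - unfold update. now rewrite Nat.eqb_refl.
  - now apply eval_update_fresh.
Qed.

(** The quantified variable is named [b], which is fresh for all the substituted terms, so no
    capture can occur. *)
Lemma dfn_body (Q : R -> (nat -> R) -> Prop) :
  dfn (fun e => Q (e O) (fun i => e (S i))) ->
  forall ts b, (forall i, vars_below b (ts i)) ->
  exists phi : formula I, forall e x,
    holds M (update e b x) phi <-> Q x (fun i => eval e (ts i)).
Proof.
  intros HQ ts b Hb.
  destruct (HQ _ _ (scons_terms_below b ts Hb)) as [phi Hphi].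
  exists phi; intros e x. rewrite Hphi.
  pose (Q' := fun e' : nat -> R => Q (e' O) (fun i => e' (S i))).
  change (Q' (fun i => eval (update e b x)
    (match i with O => Var b | S i => ts i end)) <->
    Q' (scons x (fun i => eval e (ts i)))).
  now rewrite (eval_scons_terms b ts e x Hb).
Qed.

Lemma dfn_ex (Q : R -> (nat -> R) -> Prop) :
  dfn (fun e => Q (e O) (fun i => e (S i))) ->
  dfn (fun e => exists x, Q x e).
Proof.
  intros HQ ts b Hb.
  destruct (dfn_body Q HQ ts b Hb) as [phi Hphi].
  exists (Ex b phi); intros e; simpl.
  split; intros [x Hx]; exists x; now apply Hphi.
Qed.

Lemma dfn_all (Q : R -> (nat -> R) -> Prop) :
  dfn (fun e => Q (e O) (fun i => e (S i))) ->
  dfn (fun e => forall x, Q x e).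
Proof.
  intros HQ ts b Hb.
  destruct (dfn_body Q HQ ts b Hb) as [phi Hphi].
  exists (All b phi); intros e; simpl.
  split; intros Hx x; now apply Hphi.
Qed.

Lemma dfn_rename (Q : (nat -> R) -> Prop) (r : nat -> nat) :
  dfn Q -> dfn (fun e => Q (fun i => e (r i))).
Proof.
  intros HQ ts b Hb. apply (HQ (fun i => ts (r i)) b). intros i; apply Hb.
Qed.

(** A definable function is not a term and cannot be substituted into a formula; its value is named
    by an existential quantifier instead. *)
Lemma dfn_fun_let tau (Q : R -> (nat -> R) -> Prop) :
  dfn_fun tau -> dfn (fun e => Q (e O) (fun i => e (S i))) ->
  dfn (fun e => Q (tau e) e).
Proof.
  intros Ht HQ.
  apply (dfn_ext (fun e => exists x, x = tau e /\ Q x e)).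
  - intros e; split.
    + now intros [x [-> H]].
    + intros H; now exists (tau e).
  - apply (dfn_ex (fun x e => x = tau e /\ Q x e)). now apply dfn_and.
Qed.

Lemma dfn_comp1 (A : R -> Prop) tau :
  dfn (fun e => A (e O)) -> dfn_fun tau -> dfn (fun e => A (tau e)).
Proof.
  intros HA Ht. now apply (dfn_fun_let tau (fun x _ => A x)).
Qed.

Lemma dfn_fun_weaken tau :
  dfn_fun tau -> dfn_fun (fun e => tau (fun i => e (S i))).
Proof.
  intros H.
  exact (dfn_rename _ (fun i => match i with O => O | S i => S (S i) end) H).
Qed.

Lemma dfn_comp2 (A : R -> R -> Prop) tau1 tau2 :
  dfn (fun e => A (e O) (e 1%nat)) -> dfn_fun tau1 -> dfn_fun tau2 ->
  dfn (fun e => A (tau1 e) (tau2 e)).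
Proof.
  intros HA H1 H2.
  apply (dfn_fun_let tau1 (fun x e => A x (tau2 e))); [easy|].
  apply (dfn_fun_let (fun e => tau2 (fun i => e (S i))) (fun y e => A (e O) y)).
  - now apply dfn_fun_weaken.
  - exact (dfn_rename _ (fun i => match i with O => 1%nat | _ => O end) HA).
Qed.

Lemma dfn_equ_terms t u : dfn (fun e => eval e t = eval e u).
Proof.
  intros ts b Hb. exists (Equ (subst ts t) (subst ts u)); intros e; simpl.
  now rewrite !eval_subst.
Qed.

Lemma dfn_rel i : dfn (fun e => M i (e O) (e 1%nat)).
Proof.
  intros ts b Hb. now exists (Rel i (ts O) (ts 1%nat)).
Qed.

Lemma dfn_fun_var n : dfn_fun (fun e => e n).
Proof. exact (dfn_equ_terms (Var 0) (Var (S n))). Qed.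

Lemma dfn_fun_cst r : dfn_fun (fun _ => r).
Proof. exact (dfn_equ_terms (Var 0) (Cst r)). Qed.

Lemma dfn_eq tau1 tau2 :
  dfn_fun tau1 -> dfn_fun tau2 -> dfn (fun e => tau1 e = tau2 e).
Proof.
  apply (dfn_comp2 (fun x y => x = y)).
  exact (dfn_equ_terms (Var 0) (Var 1)).
Qed.

(** The language has no order symbol: a positive number is a nonzero square. *)
Lemma dfn_lt tau1 tau2 :
  dfn_fun tau1 -> dfn_fun tau2 -> dfn (fun e => tau1 e < tau2 e).
Proof.
  apply (dfn_comp2 (fun x y => x < y)).
  apply (dfn_ext (fun e => exists z, ~ z = 0 /\ e O + z * z = e 1%nat)).
  - intros e; split.
    + intros [z [Hz <-]]. nra.
    + intros H. exists (sqrt (e 1%nat - e O)).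
      assert (H1 := sqrt_lt_R0 (e 1%nat - e O) ltac:(lra)).
      split; [lra|]. rewrite sqrt_sqrt; lra.
  - apply (dfn_ex (fun z e => ~ z = 0 /\ e O + z * z = e 1%nat)).
    apply dfn_and.
    + apply dfn_not. exact (dfn_equ_terms (Var 0) (Cst 0)).
    + exact (dfn_equ_terms (Add (Var 1) (Mul (Var 0) (Var 0))) (Var 2)).
Qed.

Lemma dfn_le tau1 tau2 :
  dfn_fun tau1 -> dfn_fun tau2 -> dfn (fun e => tau1 e <= tau2 e).
Proof.
  intros H1 H2. apply (dfn_ext (fun e => ~ tau2 e < tau1 e)).
  - intros e; split; lra.
  - now apply dfn_not, dfn_lt.
Qed.

Lemma dfn_fun_comp1 (f : R -> R) tau :
  dfn (fun e => e O = f (e 1%nat)) -> dfn_fun tau -> dfn_fun (fun e => f (tau e)).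
Proof.
  intros Hf Ht. unfold dfn_fun.
  apply (dfn_comp2 (fun x y => x = f y) (fun e => e O) (fun e => tau (fun i => e (S i)))).
  - exact Hf.
  - apply dfn_fun_var.
  - now apply dfn_fun_weaken.
Qed.

Lemma dfn_fun_comp2 (f : R -> R -> R) tau1 tau2 :
  dfn (fun e => e O = f (e 1%nat) (e 2%nat)) -> dfn_fun tau1 -> dfn_fun tau2 ->
  dfn_fun (fun e => f (tau1 e) (tau2 e)).
Proof.
  intros Hf H1 H2. unfold dfn_fun.
  apply (dfn_fun_let (fun e => tau1 (fun i => e (S i)))
           (fun x e => e O = f x (tau2 (fun i => e (S i))))).
  - now apply dfn_fun_weaken.
  - apply (dfn_fun_let (fun e => tau2 (fun i => e (S (S i))))
           (fun y e => e 1%nat = f (e O) y)).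
    + now apply (dfn_fun_weaken (fun e => tau2 (fun i => e (S i)))), dfn_fun_weaken.
    + exact (dfn_rename _ (fun i => match i with O => 2%nat | 1%nat => 1%nat | _ => O end) Hf).
Qed.

Lemma dfn_fun_add tau1 tau2 :
  dfn_fun tau1 -> dfn_fun tau2 -> dfn_fun (fun e => tau1 e + tau2 e).
Proof.
  apply dfn_fun_comp2. exact (dfn_equ_terms (Var 0) (Add (Var 1) (Var 2))).
Qed.

Lemma dfn_fun_mul tau1 tau2 :
  dfn_fun tau1 -> dfn_fun tau2 -> dfn_fun (fun e => tau1 e * tau2 e).
Proof.
  apply dfn_fun_comp2. exact (dfn_equ_terms (Var 0) (Mul (Var 1) (Var 2))).
Qed.

Lemma dfn_fun_opp tau : dfn_fun tau -> dfn_fun (fun e => - tau e).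
Proof.
  apply dfn_fun_comp1.
  apply (dfn_ext (fun e => e O = (-1) * e 1%nat)).
  - intros e; split; lra.
  - exact (dfn_equ_terms (Var 0) (Mul (Cst (-1)) (Var 1))).
Qed.

Lemma dfn_fun_sub tau1 tau2 :
  dfn_fun tau1 -> dfn_fun tau2 -> dfn_fun (fun e => tau1 e - tau2 e).
Proof. intros H1 H2. now apply dfn_fun_add, dfn_fun_opp. Qed.

Lemma dfn_fun_pow tau k : dfn_fun tau -> dfn_fun (fun e => tau e ^ k).
Proof.
  intros H; induction k as [|k IH]; simpl.
  - apply dfn_fun_cst.
  - now apply dfn_fun_mul.
Qed.

Lemma dfn_fun_abs tau : dfn_fun tau -> dfn_fun (fun e => Rabs (tau e)).
Proof.
  apply dfn_fun_comp1.
  apply (dfn_ext (fun e => (0 <= e 1%nat /\ e O = e 1%nat) \/ (e 1%nat < 0 /\ e O = - e 1%nat))).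
  - intros e; unfold Rabs; destruct (Rcase_abs (e 1%nat)); lra.
  - apply dfn_or; apply dfn_and.
    + apply dfn_le; [apply dfn_fun_cst|apply dfn_fun_var].
    + apply dfn_eq; apply dfn_fun_var.
    + apply dfn_lt; [apply dfn_fun_var|apply dfn_fun_cst].
    + apply dfn_eq; [|apply dfn_fun_opp]; apply dfn_fun_var.
Qed.

Lemma dfn_definable (A : R -> Prop) : dfn (fun e => A (e O)) -> definable M A.
Proof.
  intros H.
  destruct (H (fun i => match i with O => Var 0 | _ => Cst 0 end) 1%nat) as [phi Hphi].
  - intros [|i]; simpl; [lia|easy].
  - now exists phi.
Qed.

End Definability.

(* [0] is a junk value, there to make the function total. *)
Definition on_pos (f : R -> R) (x : R) : R := if Rlt_dec 0 x then f x else 0.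

Lemma on_pos_pos f x : 0 < x -> on_pos f x = f x.
Proof. intros H; unfold on_pos; now destruct (Rlt_dec 0 x). Qed.

Lemma dfn_fun_on_pos {I} (M : I -> R -> R -> Prop) i f tau :
  (forall x y, M i x y <-> graph_pos f x y) ->
  dfn_fun M tau -> dfn_fun M (fun e => on_pos f (tau e)).
Proof.
  intros Hi. apply dfn_fun_comp1.
  apply (dfn_ext M (fun e => M i (e 1%nat) (e O) \/ (e 1%nat <= 0 /\ e O = 0))).
  - intros e. rewrite Hi. unfold graph_pos, on_pos.
    destruct (Rlt_dec 0 (e 1%nat)); intuition lra.
  - apply dfn_or.
    + exact (dfn_rename M _ (fun i => match i with O => 1%nat | _ => O end) (dfn_rel M i)).
    + apply dfn_and; [apply dfn_le|apply dfn_eq]; apply dfn_fun_var || apply dfn_fun_cst.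
Qed.

Ltac definability_step :=
  match goal with
  | |- dfn _ (fun e => _ /\ _) => apply dfn_and
  | |- dfn _ (fun e => _ \/ _) => apply dfn_or
  | |- dfn _ (fun e => ~ _) => apply dfn_not
  | |- dfn _ (fun e => exists x, @?Q e x) => apply (dfn_ex _ (fun x e => Q e x)); cbv beta
  | |- dfn _ (fun e => @?P e -> @?Q e) => apply (dfn_imp _ P Q)
  | |- dfn _ (fun e => forall x : R, @?Q e x) => apply (dfn_all _ (fun x e => Q e x)); cbv beta
  | |- dfn _ (fun e => _ = _) => apply dfn_eq
  | |- dfn _ (fun e => _ < _) => apply dfn_lt
  | |- dfn _ (fun e => _ > _) => apply dfn_lt
  | |- dfn _ (fun e => _ <= _) => apply dfn_le
  | |- dfn_fun _ (fun e => e ?n) => apply dfn_fun_var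
  | |- dfn_fun _ (fun e => ?r) => apply dfn_fun_cst
  | |- dfn_fun _ (fun e => _ + _) => apply dfn_fun_add
  | |- dfn_fun _ (fun e => _ - _) => apply dfn_fun_sub
  | |- dfn_fun _ (fun e => _ * _) => apply dfn_fun_mul
  | |- dfn_fun _ (fun e => - _) => apply dfn_fun_opp
  | |- dfn_fun _ (fun e => Rabs _) => apply dfn_fun_abs
  | |- dfn_fun _ (fun e => _ ^ _) => apply dfn_fun_pow
  end.

Ltac definability := repeat (definability_step || eassumption).

(** * Canonical products *)

Lemma sum_n_diff_le (a M : nat -> R) n m :
  (forall k, Rabs (a k) <= M k) -> (m <= n)%nat ->
  Rabs (sum_n a n - sum_n a m) <= sum_n M n - sum_n M m.
Proof.
  intros H Hmn. induction Hmn as [|n Hmn IH].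
  - rewrite !Rminus_diag, Rabs_R0; lra.
  - rewrite !sum_Sn. unfold plus; simpl.
    replace (sum_n a n + a (S n) - sum_n a m)
      with ((sum_n a n - sum_n a m) + a (S n)) by ring.
    eapply Rle_trans; [apply Rabs_triang|].
    specialize (H (S n)). lra.
Qed.

Lemma CVU_dom_Weierstrass (f : nat -> R -> R) (M : nat -> R) (D : R -> Prop) :
  ex_series M -> (forall n x, D x -> Rabs (f n x) <= M n) ->
  CVU_dom (fun n x => sum_n (fun k => f k x) n) D.
Proof.
  intros HM Hf. apply CVU_dom_cauchy. intros eps.
  assert (HC : ex_lim_seq_cauchy (sum_n M)).
  { apply ex_lim_seq_cauchy_corr. destruct HM as [l Hl]. now exists l. }
  destruct (HC eps) as [N HN]. exists N. intros n m x Hx Hn Hm.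
  specialize (HN n m Hn Hm).
  eapply Rle_lt_trans; [|exact HN].
  destruct (Nat.le_ge_cases m n) as [H|H].
  - eapply Rle_trans; [apply (sum_n_diff_le _ M)|apply Rle_abs]; auto.
  - rewrite Rabs_minus_sym, (Rabs_minus_sym (sum_n M n)).
    eapply Rle_trans; [apply (sum_n_diff_le _ M)|apply Rle_abs]; auto.
Qed.

(** One majorant serves both series. It is asked for on [(0, X)] only, because the estimates for
    canonical products grow with the argument. *)
Lemma is_derive_Series (f d : nat -> R -> R) (M : nat -> R) (X x : R) :
  0 < x < X -> ex_series M ->
  (forall n t, 0 < t < X -> Rabs (f n t) <= M n) ->
  (forall n t, 0 < t < X -> Rabs (d n t) <= M n) ->
  (forall n t, 0 < t < X -> is_derive (f n) t (d n t)) ->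
  (forall n t, 0 < t < X -> continuity_pt (d n) t) ->
  is_derive (fun t => Series (fun n => f n t)) x (Series (fun n => d n x)).
Proof.
  intros Hx HM Hf Hd Hder Hcont.
  set (D := fun t => 0 < t < X).
  assert (HD : open D).
  { apply (open_and (fun t => 0 < t) (fun t => t < X)); [apply open_gt|apply open_lt]. }
  assert (HS : forall n t, D t -> is_derive (fun y => sum_n (fun k => f k y) n) t
             (sum_n (fun k => d k t) n)).
  { intros n t Ht. apply (is_derive_sum_n f n t (fun k => d k t)). auto. }
  assert (Hloc : forall n t, D t -> locally t (fun y =>
      sum_n (fun k => d k y) n = Derive (fun y => sum_n (fun k => f k y) n) y)).
  { intros n t Ht. generalize (HD t Ht). apply filter_imp. intros y Hy.
    symmetry. now apply is_derive_unique, HS. }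
  assert (H := CVU_Derive (fun n t => sum_n (fun k => f k t) n) D HD).
  replace (Series (fun n => d n x)) with
    (real (Lim_seq (fun n => Derive (fun t => sum_n (fun k => f k t) n) x))).
  - apply H; auto.
    + intros a b c Ha Hb Hc; unfold D in *; lra.
    + now apply (CVU_dom_Weierstrass f M).
    + intros n t Ht. eexists. now apply HS.
    + intros n t Ht.
      apply (continuity_pt_ext_loc (fun t => sum_n (fun k => d k t) n)).
      { apply (Hloc n t Ht). }
      clear - Hcont Ht.
      apply continuity_pt_filterlim.
      induction n as [|n IH].
      * apply (continuous_ext (d O)).
        { intros y; now rewrite sum_O. }
        now apply continuity_pt_filterlim, Hcont.
      * apply (continuous_ext (fun y => sum_n (fun k => d k y) n + d (S n) y)).
        { intros y; now rewrite sum_Sn. }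
        apply (continuous_plus (V := R_NormedModule)); [exact IH|].
        now apply continuity_pt_filterlim, Hcont.
    + assert (HW := CVU_dom_Weierstrass d M D HM Hd).
      intros eps. destruct (HW eps) as [N HN]. exists N. intros n Hn t Ht.
      assert (HE : forall m, Derive (fun y : R => sum_n (fun k => f k y) m) t
                             = sum_n (fun k => d k t) m).
      { intros m. now apply is_derive_unique, HS. }
      rewrite HE, (Lim_seq_ext _ (fun n => sum_n (fun k => d k t) n)).
      * now apply HN.
      * exact HE.
  - unfold Series. f_equal. apply Lim_seq_ext. intros n.
    now apply is_derive_unique, HS.
Qed.

(** The logarithm of the Weierstrass primary factor [E_p] at [- u]. *)
Definition log_factor (p : nat) (u : R) : R :=
  ln (1 + u) + sum_n_m (fun j => (-1) ^ j * u ^ j / INR j) 1 p.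

(** The derivatives of the polynomial terms cancel the first [p] terms of the geometric expansion of
    [1 / (1 + u)], and its remainder is left. *)
Lemma is_derive_log_factor p u :
  0 <= u -> is_derive (log_factor p) u ((-1) ^ p * u ^ p / (1 + u)).
Proof.
  intros Hu. induction p as [|p IH].
  - apply (is_derive_ext (fun u => ln (1 + u))).
    { intros t. unfold log_factor. rewrite sum_n_m_zero by lia.
      unfold zero; simpl; ring. }
    auto_derive; [lra|]. simpl; field; lra.
  - apply (is_derive_ext (fun u =>
      log_factor p u + (-1) ^ (S p) * u ^ (S p) / INR (S p))).
    { intros t. unfold log_factor. rewrite sum_n_Sm by lia. unfold plus; simpl; ring. }
    replace ((-1) ^ S p * u ^ S p / (1 + u)) with
      ((-1) ^ p * u ^ p / (1 + u) + (-1) ^ S p * u ^ p).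
    + apply (is_derive_plus (V := R_NormedModule)); [exact IH|].
      auto_derive; [exact I|].
      replace (match p with O => 1 | S _ => INR p + 1 end) with (INR p + 1)
        by (destruct p; simpl; ring).
      assert (0 <= INR p) by apply pos_INR. simpl. field. lra.
    + simpl. field. lra.
Qed.

Lemma log_factor_0 p : log_factor p 0 = 0.
Proof.
  unfold log_factor. rewrite Rplus_0_r, ln_1.
  rewrite (sum_n_m_ext_loc _ (fun _ => zero)).
  - rewrite sum_n_m_const_zero. unfold zero; simpl; ring.
  - intros k Hk. rewrite pow_i by lia. unfold zero; simpl.
    unfold Rdiv. ring.
Qed.

Lemma Rabs_pow_neg1 p : Rabs ((-1) ^ p) = 1.
Proof. apply pow_1_abs. Qed.

Lemma Rabs_sign_mul p x : 0 <= x -> Rabs ((-1) ^ p * x) = x.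
Proof. intros H. now rewrite Rabs_mult, Rabs_pow_neg1, Rabs_pos_eq, Rmult_1_l. Qed.

Lemma div_le_l x y : 0 <= x -> 1 <= y -> x / y <= x.
Proof.
  intros Hx Hy. apply (Rmult_le_reg_r y); [lra|].
  unfold Rdiv. rewrite Rmult_assoc, Rinv_l by lra. nra.
Qed.

(** Mean value theorem from [0], where the function vanishes; on the way the derivative is at most
    [u ^ p] in absolute value. *)
Lemma log_factor_bound p u : 0 < u -> Rabs (log_factor p u) <= u ^ S p.
Proof.
  intros Hu.
  destruct (MVT_gen (log_factor p) 0 u (fun v => (-1) ^ p * v ^ p / (1 + v)))
    as [c [Hc Heq]].
  - intros v Hv. rewrite Rmin_left, Rmax_right in Hv by lra.
    apply is_derive_log_factor; lra.
  - intros v Hv. rewrite Rmin_left, Rmax_right in Hv by lra.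
    apply continuity_pt_filterlim, @ex_derive_continuous. eexists.
    apply is_derive_log_factor; lra.
  - rewrite Rmin_left, Rmax_right in Hc by lra.
    rewrite log_factor_0, !Rminus_0_r in Heq. rewrite Heq.
    replace ((-1) ^ p * c ^ p / (1 + c) * u) with ((-1) ^ p * (c ^ p / (1 + c) * u))
      by (field; lra).
    assert (0 <= c ^ p) by (apply pow_le; lra).
    assert (c ^ p <= u ^ p) by (apply pow_incr; lra).
    assert (H1 := div_le_l (c ^ p) (1 + c) ltac:(lra) ltac:(lra)).
    assert (0 <= c ^ p / (1 + c)) by (apply Rdiv_le_0_compat; lra).
    rewrite Rabs_sign_mul by nra. simpl. nra.
Qed.

(* [(-1) ^ p * kern p u] is [v * (v L' v)'] at [v = u], [L = log_factor p]. *)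
Definition kern (p : nat) (u : R) : R :=
  (INR (S p) * u ^ S p + INR p * u ^ S (S p)) / (1 + u) ^ 2.

Lemma is_derive_kern p u :
  0 <= u ->
  is_derive (fun v => (-1) ^ p * v ^ S p / (1 + v)) u
    ((-1) ^ p * ((INR (S p) * u ^ p + INR p * u ^ S p) / (1 + u) ^ 2)).
Proof.
  intros Hu. auto_derive; [lra|].
  rewrite S_INR. replace (match p with O => 1 | S _ => INR p + 1 end) with (INR p + 1)
        by (destruct p; simpl; ring).
  simpl. field. lra.
Qed.

Section CanonicalProduct.
Context (a : nat -> R) (p : nat).
Hypothesis a_pos : forall n, 0 < a n.
Hypothesis a_sum : ex_series (fun n => / a n ^ S p).

Lemma div_pos n t : 0 < t -> 0 < t / a n.
Proof. intros H. now apply Rdiv_lt_0_compat. Qed.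

Lemma is_derive_scaled (f : R -> R) n t l :
  is_derive f (t / a n) l -> is_derive (fun t => f (t / a n)) t (/ a n * l).
Proof.
  intros H.
  apply (is_derive_comp (V := R_NormedModule) f (fun t => t / a n) t l (/ a n) H).
  assert (Ha := a_pos n). auto_derive; [easy|]. field. lra.
Qed.

Lemma pow_div_bound n t X k :
  0 < t < X -> (t / a n) ^ k <= X ^ k * / a n ^ k.
Proof.
  intros Ht. unfold Rdiv. rewrite Rpow_mult_distr, pow_inv.
  apply Rmult_le_compat_r.
  - left. apply Rinv_0_lt_compat, pow_lt, a_pos.
  - apply pow_incr; lra.
Qed.

Definition log_deriv_term (n : nat) (t : R) : R :=
  / a n * ((-1) ^ p * (t / a n) ^ p / (1 + t / a n)).

Definition kern_term (n : nat) (t : R) : R :=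
  / a n * ((-1) ^ p * ((INR (S p) * (t / a n) ^ p + INR p * (t / a n) ^ S p)
     / (1 + t / a n) ^ 2)).

Lemma log_deriv_term_bound n t X :
  0 < t < X -> Rabs (log_deriv_term n t) <= X ^ p * / a n ^ S p.
Proof.
  intros Ht. unfold log_deriv_term.
  assert (Hu := div_pos n t ltac:(lra)).
  assert (Ha := Rinv_0_lt_compat _ (a_pos n)).
  replace (/ a n * ((-1) ^ p * (t / a n) ^ p / (1 + t / a n))) with
    ((-1) ^ p * (/ a n * ((t / a n) ^ p / (1 + t / a n)))) by (unfold Rdiv; ring).
  assert (0 < (t / a n) ^ p) by now apply pow_lt.
  assert (H1 := div_le_l ((t / a n) ^ p) (1 + t / a n) ltac:(lra) ltac:(lra)).
  assert (0 < (t / a n) ^ p / (1 + t / a n)) by (apply Rdiv_lt_0_compat; lra).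
  rewrite Rabs_sign_mul by nra.
  assert (H2 := pow_div_bound n t X p Ht).
  simpl. rewrite Rinv_mult. nra.
Qed.

Lemma kern_term_bound n t X :
  0 < t < X -> Rabs (kern_term n t) <= INR (S p) * X ^ p * / a n ^ S p.
Proof.
  intros Ht. unfold kern_term.
  assert (Hu := div_pos n t ltac:(lra)).
  assert (Ha := Rinv_0_lt_compat _ (a_pos n)).
  set (u := t / a n) in *.
  replace (/ a n * ((-1) ^ p * ((INR (S p) * u ^ p + INR p * u ^ S p) / (1 + u) ^ 2)))
    with ((-1) ^ p * (/ a n * ((INR (S p) * u ^ p + INR p * u ^ S p) / (1 + u) ^ 2)))
    by ring.
  assert (Hp : 0 < u ^ p) by now apply pow_lt.
  assert (HI := pos_INR p).
  assert (H1 : 0 <= (INR (S p) * u ^ p + INR p * u ^ S p) / (1 + u) ^ 2 <= INR (S p) * u ^ p).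
  { rewrite S_INR. simpl. split.
    - apply Rdiv_le_0_compat; [|nra]. assert (0 < u * u ^ p) by nra. nra.
    - apply (Rmult_le_reg_r ((1 + u) * ((1 + u) * 1))); [nra|].
      unfold Rdiv. rewrite Rmult_assoc, Rinv_l by nra.
      assert (0 < u * u ^ p) by nra. assert (0 < u * u * u ^ p) by nra.
      assert (0 <= INR p * (u * u ^ p)) by (apply Rmult_le_pos; lra).
      assert (0 <= INR p * (u * u * u ^ p)) by (apply Rmult_le_pos; lra).
      nra. }
  rewrite Rabs_sign_mul by nra.
  assert (H2 := pow_div_bound n t X p Ht). fold u in H2.
  assert (0 < INR (S p)) by (rewrite S_INR; lra).
  apply Rle_trans with (/ a n * (INR (S p) * (X ^ p * / a n ^ p))).
  { apply Rmult_le_compat_l; [lra|]. apply Rle_trans with (INR (S p) * u ^ p); [lra|].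
    apply Rmult_le_compat_l; lra. }
  rewrite <- (tech_pow_Rmult (a n) p), Rinv_mult. apply Req_le. ring.
Qed.

Lemma is_derive_log_series x :
  0 < x ->
  is_derive (fun t => Series (fun n => log_factor p (t / a n))) x
    (Series (fun n => log_deriv_term n x)).
Proof.
  intros Hx.
  apply (is_derive_Series (fun n t => log_factor p (t / a n)) log_deriv_term
    (fun n => ((x + 1) ^ S p + (x + 1) ^ p) * / a n ^ S p) (x + 1)); [lra| | | | |].
  - apply (ex_series_scal (V := R_NormedModule) ((x + 1) ^ S p + (x + 1) ^ p)).
    exact a_sum.
  - intros n t Ht. eapply Rle_trans; [apply log_factor_bound, div_pos; lra|].
    eapply Rle_trans; [apply (pow_div_bound n t (x + 1)); lra|].
    apply Rmult_le_compat_r.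
    + left; apply Rinv_0_lt_compat, pow_lt, a_pos.
    + assert (0 < (x + 1) ^ p) by (apply pow_lt; lra). lra.
  - intros n t Ht. eapply Rle_trans; [apply (log_deriv_term_bound n t (x + 1)); lra|].
    apply Rmult_le_compat_r.
    + left; apply Rinv_0_lt_compat, pow_lt, a_pos.
    + assert (0 < (x + 1) ^ S p) by (apply pow_lt; lra). lra.
  - intros n t Ht. apply (is_derive_scaled (log_factor p)), is_derive_log_factor.
    left; apply div_pos; lra.
  - intros n t Ht. apply continuity_pt_filterlim, @ex_derive_continuous.
    assert (Ha := a_pos n). assert (Hu := div_pos n t ltac:(lra)).
    unfold log_deriv_term. auto_derive. unfold Rdiv in Hu. lra.
Qed.

Lemma is_derive_kern_series x :
  0 < x ->
  is_derive (fun t => Series (fun n => t * log_deriv_term n t)) x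
    (Series (fun n => kern_term n x)).
Proof.
  intros Hx.
  apply (is_derive_Series (fun n t => t * log_deriv_term n t) kern_term
    (fun n => ((x + 1) * (x + 1) ^ p + INR (S p) * (x + 1) ^ p) * / a n ^ S p) (x + 1)); [lra| | | | |].
  - apply (ex_series_scal (V := R_NormedModule) ((x + 1) * (x + 1) ^ p + INR (S p) * (x + 1) ^ p)).
    exact a_sum.
  - intros n t Ht. rewrite Rabs_mult, (Rabs_pos_eq t) by lra.
    assert (H := log_deriv_term_bound n t (x + 1) ltac:(lra)).
    assert (0 <= Rabs (log_deriv_term n t)) by apply Rabs_pos.
    assert (0 < / a n ^ S p) by (apply Rinv_0_lt_compat, pow_lt, a_pos).
    assert (0 < (x + 1) ^ p) by (apply pow_lt; lra).
    assert (0 < INR (S p)) by (apply lt_0_INR; lia).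
    assert (0 < (x + 1) ^ p * / a n ^ S p) by nra.
    assert (0 < INR (S p) * ((x + 1) ^ p * / a n ^ S p)) by nra.
    nra.
  - intros n t Ht. eapply Rle_trans; [apply (kern_term_bound n t (x + 1)); lra|].
    apply Rmult_le_compat_r.
    + left; apply Rinv_0_lt_compat, pow_lt, a_pos.
    + assert (0 < (x + 1) ^ p) by (apply pow_lt; lra). nra.
  - intros n t Ht. assert (Ha := a_pos n). assert (Hu := div_pos n t ltac:(lra)).
    apply (is_derive_ext_loc (fun t => (-1) ^ p * (t / a n) ^ S p / (1 + t / a n))).
    + assert (HD : open (fun t => 0 < t)) by apply open_gt.
      generalize (HD t ltac:(lra)). apply filter_imp. intros y Hy.
      assert (Hv := div_pos n y Hy).
      unfold log_deriv_term. simpl. field. split; [|lra].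
      assert (y / a n * a n = y) by (field; lra). nra.
    + apply (is_derive_scaled (fun v => (-1) ^ p * v ^ S p / (1 + v))), is_derive_kern. lra.
  - intros n t Ht. apply continuity_pt_filterlim, @ex_derive_continuous.
    assert (Ha := a_pos n). assert (Hu := div_pos n t ltac:(lra)).
    unfold kern_term. auto_derive. unfold Rdiv in Hu.
    apply Rgt_not_eq. nra.
Qed.

Lemma ex_series_log_factor x : 0 < x -> ex_series (fun n => log_factor p (x / a n)).
Proof.
  intros Hx. apply (ex_series_le (V := R_CompleteNormedModule) _ (fun n => (x + 1) ^ S p * / a n ^ S p)).
  - intros n. eapply Rle_trans; [apply log_factor_bound, div_pos; lra|].
    apply pow_div_bound; lra.
  - apply (ex_series_scal (V := R_NormedModule) ((x + 1) ^ S p)). exact a_sum.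
Qed.

(** The partial products have a finite limit here, so the default value in [inf_prod] does not
    interfere. *)
Lemma inf_prod_exp (b l : nat -> R) :
  (forall n, b (S n) = exp (l n)) -> ex_series l -> inf_prod b = exp (Series l).
Proof.
  intros Hb Hl. unfold inf_prod.
  rewrite (Lim_seq_ext _ (fun n => exp (sum_n l n))).
  - rewrite (is_lim_seq_unique _ (exp (Series l))); [easy|].
    apply is_lim_seq_continuous.
    + apply continuity_pt_filterlim, @ex_derive_continuous. auto_derive. easy.
    + apply Series_correct in Hl. exact Hl.
  - intros n. induction n as [|n IH]; simpl.
    + now rewrite sum_O, Hb.
    + now rewrite sum_Sn, IH, Hb, <- exp_plus.
Qed.

(** On the positive half-line [G] is the exponential of a series, and both differentiations may be
    carried out term by term. The factor [x] makes each resulting term depend on [x / a n] only. *)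
Lemma d_xlogder_canonical (G : R -> R) (factor : R -> nat -> R) x :
  (forall t, 0 < t -> G t = inf_prod (factor t)) ->
  (forall t n, 0 < t -> factor t (S n) = exp (log_factor p (t / a n))) ->
  0 < x ->
  x * d_xlogder G x = (-1) ^ p * Series (fun n => kern p (x / a n)).
Proof.
  intros HG Hf Hx.
  assert (HD : open (fun t => 0 < t)) by apply open_gt.
  assert (HE : forall t, 0 < t ->
    G t = exp (Series (fun n => log_factor p (t / a n)))).
  { intros t Ht. rewrite HG by easy. apply inf_prod_exp.
    - intros n; now apply Hf.
    - now apply ex_series_log_factor. }
  assert (HG' : forall t, 0 < t ->
    t * Derive G t / G t = Series (fun n => t * log_deriv_term n t)).
  { intros t Ht. rewrite Series_scal_l.
    assert (Hder : is_derive G t (Series (fun n => log_deriv_term n t) *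
              exp (Series (fun n => log_factor p (t / a n))))).
    { apply (is_derive_ext_loc (fun t => exp (Series (fun n => log_factor p (t / a n))))).
      - generalize (HD t Ht). apply filter_imp. intros y Hy. symmetry. now apply HE.
      - apply (is_derive_comp (V := R_NormedModule) exp (fun t => Series (fun n => log_factor p (t / a n)))).
        + apply is_derive_exp.
        + now apply is_derive_log_series. }
    rewrite (is_derive_unique _ _ _ Hder), HE by easy.
    field. apply Rgt_not_eq, exp_pos. }
  unfold d_xlogder.
  rewrite (is_derive_unique _ x (Series (fun n => kern_term n x))).
  - rewrite <- !Series_scal_l. apply Series_ext. intros n.
    unfold kern_term, kern.
    assert (Ha := a_pos n). assert (Hu := div_pos n x Hx).
    set (u := x / a n) in *. replace x with (u * a n) by (unfold u; field; lra).
    simpl. field. split; lra.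
  - apply (is_derive_ext_loc (fun t => Series (fun n => t * log_deriv_term n t))).
    + generalize (HD x Hx). apply filter_imp. intros y Hy. symmetry. now apply HG'.
    + now apply is_derive_kern_series.
Qed.

End CanonicalProduct.

(** * Subgroups of the line *)

Lemma discrete_subgroup_cyclic (H : R -> Prop) (delta x0 : R) :
  (forall x y, H x -> H y -> H (x - y)) -> H x0 -> 0 < x0 -> 0 < delta ->
  (forall x, H x -> ~ 0 < x < delta) ->
  exists g, 0 < g /\ H g /\ forall x, H x -> exists m : Z, x = IZR m * g.
Proof.
  intros Hsub Hx0 Hx0pos Hd Hgap.
  assert (H0 : H 0) by (replace 0 with (x0 - x0) by ring; auto).
  assert (Hopp : forall x, H x -> H (- x)).
  { intros x Hx. replace (- x) with (0 - x) by ring. auto. }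
  assert (Hadd : forall x y, H x -> H y -> H (x + y)).
  { intros x y Hx Hy. replace (x + y) with (x - - y) by ring. auto. }
  assert (Hmul : forall x (m : Z), H x -> H (IZR m * x)).
  { intros x m Hx.
    assert (Hnat : forall n : nat, H (INR n * x)).
    { induction n as [|n IH]; [simpl; now rewrite Rmult_0_l|].
      rewrite S_INR, Rmult_plus_distr_r, Rmult_1_l. auto. }
    destruct (Z_le_gt_dec 0 m) as [Hm|Hm].
    - rewrite <- (Z2Nat.id m Hm), <- INR_IZR_INZ. apply Hnat.
    - replace (IZR m * x) with (- (INR (Z.to_nat (- m)) * x)); [auto|].
      rewrite INR_IZR_INZ, Z2Nat.id, opp_IZR by lia. ring. }
  (* [completeness] yields suprema, so the infimum of the positive elements appears as [- l]. A
     positive element within [delta] of it is already the least one: a smaller one would differ from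
     it by less than [delta]. *)
  destruct (completeness (fun y => H y /\ y < 0)) as [l [Hl1 Hl2]].
  - exists 0. intros y [_ Hy]. lra.
  - exists (- x0). split; [auto|lra].
  - assert (Hy : exists y, H y /\ 0 < y /\ y < - l + delta).
    { apply NNPP. intros Hno. assert (l <= l - delta); [|lra].
      apply Hl2. intros y [Hy1 Hy2]. apply Rnot_lt_le. intros Hlt.
      apply Hno. exists (- y). repeat split; [auto|lra|lra]. }
    destruct Hy as [g [Hg [Hgpos Hgl]]].
    assert (Hmin : forall z, H z -> ~ 0 < z < g).
    { intros z Hz Hzg. apply (Hgap (g - z)); [auto|].
      assert (- z <= l) by (apply Hl1; split; [auto|lra]). lra. }
    exists g. repeat split; auto. intros x Hx.
    exists (Int_part (x / g)).
    destruct (base_Int_part (x / g)) as [Hi1 Hi2].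
    set (m := Int_part (x / g)) in *.
    assert (Hxg : x = x / g * g) by (field; lra).
    specialize (Hmin (x - IZR m * g) ltac:(auto)).
    assert (0 <= x - IZR m * g) by nra.
    assert (x - IZR m * g < g) by nra.
    lra.
Qed.

Lemma frac_part_eq x (k : Z) r : 0 <= r < 1 -> x = IZR k + r -> frac_part x = r.
Proof. intros Hr Hx. symmetry. now apply (Int_part_frac_part_spec x k). Qed.

Lemma floor_multiple x e : 0 <= x -> 0 < e ->
  exists k : nat, x < INR k * e <= x + e.
Proof.
  intros Hx He. destruct (archimed (x / e)) as [H1 H2].
  assert (0 <= x / e) by (apply Rdiv_le_0_compat; lra).
  exists (Z.to_nat (up (x / e))).
  rewrite INR_IZR_INZ, Z2Nat.id by (apply le_IZR; lra).
  assert (x = x / e * e) by (field; lra). nra.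
Qed.

(** The group [Z + Z rho] is not cyclic, so it contains a positive [e] shorter than the target
    interval, and the multiples of [e] cannot jump over that interval. *)
Lemma frac_part_multiples_dense (rho x y : R) :
  (forall i j : Z, IZR j * rho = IZR i -> j = 0%Z) ->
  0 <= x -> x < y -> y <= 1 ->
  exists n : nat, x < frac_part (INR n * rho) < y.
Proof.
  intros Hirr Hx Hxy Hy.
  assert (Hsmall : exists i j : Z, 0 < IZR i + IZR j * rho < y - x).
  { apply NNPP. intros Hno.
    destruct (discrete_subgroup_cyclic
      (fun z => exists i j : Z, z = IZR i + IZR j * rho) (y - x) 1) as [g [Hg [_ Hc]]].
    - intros u v [i [j ->]] [i' [j' ->]]. exists (i - i')%Z, (j - j')%Z.
      rewrite !minus_IZR. ring.
    - exists 1%Z, 0%Z. lra.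
    - lra.
    - lra.
    - intros z [i [j ->]] Hz. apply Hno. now exists i, j.
    - destruct (Hc 1) as [m Hm]. { exists 1%Z, 0%Z. lra. }
      destruct (Hc rho) as [k Hk]. { exists 0%Z, 1%Z. lra. }
      assert (m = 0%Z) by (apply (Hirr k m); transitivity (IZR k * (IZR m * g));
          [rewrite Hk; ring | rewrite <- Hm; ring]).
      subst m. lra. }
  destruct Hsmall as [i [j He]]. set (e := IZR i + IZR j * rho) in *.
  destruct (Z_lt_le_dec 0 j) as [Hj|Hj].
  - destruct (floor_multiple x e) as [k Hk]; [lra|lra|].
    exists (k * Z.to_nat j)%nat.
    rewrite (frac_part_eq _ (- (Z.of_nat k * i)) (INR k * e)); [lra|lra|].
    rewrite mult_INR, opp_IZR, mult_IZR, <- INR_IZR_INZ.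
    rewrite (INR_IZR_INZ (Z.to_nat j)), Z2Nat.id by lia. unfold e. ring.
  (* The index [n] must be natural: when [j] is not positive, the multiples of [- j] move the
     fractional part down from [1] in steps of [e]. *)
  - destruct (floor_multiple (1 - y) e) as [k Hk]; [lra|lra|].
    exists (k * Z.to_nat (- j))%nat.
    assert (Hk0 : 0 < INR k * e) by lra.
    rewrite (frac_part_eq _ (Z.of_nat k * i - 1) (1 - INR k * e)); [lra|lra|].
    rewrite mult_INR, minus_IZR, mult_IZR, <- INR_IZR_INZ.
    rewrite (INR_IZR_INZ (Z.to_nat (- j))), Z2Nat.id by lia.
    rewrite opp_IZR. unfold e. ring.
Qed.

(** * Sums of dilates *)

(** Sums over the half-open range [n < k], unlike [sum_n]: the empty sum exists and consecutive
    blocks fit together. *)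
Fixpoint psum (a : nat -> R) (k : nat) : R :=
  match k with O => 0 | S k => psum a k + a k end.

Lemma sum_n_psum a k : sum_n a k = psum a (S k).
Proof.
  induction k as [|k IH].
  - rewrite sum_O. simpl. now rewrite Rplus_0_l.
  - rewrite sum_Sn, IH. easy.
Qed.

Lemma psum_le a b k : (forall n, (n < k)%nat -> a n <= b n) -> psum a k <= psum b k.
Proof.
  induction k as [|k IH]; intros H; simpl; [lra|].
  assert (a k <= b k) by (apply H; lia).
  assert (psum a k <= psum b k) by (apply IH; intros; apply H; lia). lra.
Qed.

Lemma psum_mono a j k : (forall n, 0 <= a n) -> (j <= k)%nat -> psum a j <= psum a k.
Proof.
  intros H Hjk. induction Hjk as [|k _ IH]; simpl; [lra|]. specialize (H k). lra.
Qed.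

Lemma psum_scal c a k : psum (fun n => c * a n) k = c * psum a k.
Proof. induction k as [|k IH]; simpl; [ring|rewrite IH; ring]. Qed.

Lemma ex_series_bounded a B :
  (forall n, 0 <= a n) -> (forall k, psum a k <= B) -> ex_series a.
Proof.
  intros Ha HB.
  destruct (ex_finite_lim_seq_incr (sum_n a) B) as [l Hl].
  - intros n. rewrite sum_Sn. specialize (Ha (S n)). unfold plus; simpl. lra.
  - intros n. rewrite sum_n_psum. apply HB.
  - now exists l.
Qed.

Lemma psum_lim a : ex_series a -> is_lim_seq (psum a) (Series a).
Proof.
  intros H. apply is_lim_seq_incr_1.
  apply (is_lim_seq_ext (sum_n a)).
  - intros n. apply sum_n_psum.
  - now apply Series_correct in H.
Qed.

Lemma Series_le_bound a B : ex_series a -> (forall k, psum a k <= B) -> Series a <= B.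
Proof.
  intros H HB.
  apply (is_lim_seq_le (psum a) (fun _ => B) (Series a) B HB).
  - now apply psum_lim.
  - apply is_lim_seq_const.
Qed.

Lemma psum_le_Series a k : ex_series a -> (forall n, 0 <= a n) -> psum a k <= Series a.
Proof.
  intros H Ha.
  apply (is_lim_seq_le_loc (fun _ => psum a k) (psum a) (psum a k) (Series a)).
  - exists k. intros n Hn. now apply psum_mono.
  - apply is_lim_seq_const.
  - now apply psum_lim.
Qed.

(** Comparison of one term with an integral, by the mean value theorem. Division by [e] lets the
    same inequality serve growing sums, where [e > 0], and tails of convergent ones, where
    [e < 0]. *)
Lemma Rpower_increment (e x : R) :
  e < 1 -> e <> 0 -> 0 < x ->
  Rpower (x + 1) (e - 1) <= (Rpower (x + 1) e - Rpower x e) / e.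
Proof.
  intros He He0 Hx.
  destruct (MVT_gen (fun y => Rpower y e) x (x + 1) (fun y => e * Rpower y (e - 1)))
    as [c [Hc Heq]].
  - intros y Hy. rewrite Rmin_left in Hy by lra.
    apply is_derive_Reals, derivable_pt_lim_power. lra.
  - intros y Hy. rewrite Rmin_left in Hy by lra.
    apply derivable_continuous_pt. eexists. apply derivable_pt_lim_power. lra.
  - rewrite Rmin_left, Rmax_right in Hc by lra. rewrite Heq.
    replace (e * Rpower c (e - 1) * (x + 1 - x) / e) with (Rpower c (e - 1)) by (field; lra).
    replace (e - 1) with (- (1 - e)) by ring. rewrite !Rpower_Ropp.
    apply Rinv_le_contravar; [apply exp_pos|].
    apply Rle_Rpower_l; lra.
Qed.

Lemma psum_Rpower_head (s : R) k :
  0 <= s < 1 ->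
  psum (fun n => Rpower (INR (S n)) (- s)) (S k) <= Rpower (INR (S k)) (1 - s) / (1 - s).
Proof.
  intros Hs. induction k as [|k IH].
  - simpl. replace (Rpower 1 (- s)) with 1 by (unfold Rpower; now rewrite ln_1, Rmult_0_r, exp_0).
    replace (Rpower 1 (1 - s)) with 1 by (unfold Rpower; now rewrite ln_1, Rmult_0_r, exp_0).
    rewrite Rplus_0_l. apply (Rmult_le_reg_r (1 - s)); [lra|].
    unfold Rdiv. rewrite Rmult_assoc, Rinv_l; lra.
  - change (psum (fun n => Rpower (INR (S n)) (- s)) (S (S k))) with
      (psum (fun n => Rpower (INR (S n)) (- s)) (S k) + Rpower (INR (S (S k))) (- s)).
    assert (Hk : 0 < INR (S k)) by (apply lt_0_INR; lia).
    assert (H := Rpower_increment (1 - s) (INR (S k))).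
    rewrite <- (S_INR (S k)) in H. replace (1 - s - 1) with (- s) in H by ring.
    (* For [s = 0] the exponent [1 - s] is [1], outside the range of [Rpower_increment]. *)
    destruct (Req_dec s 0) as [->|Hs0].
    + rewrite Ropp_0, Rminus_0_r in *. rewrite Rdiv_1_r in *.
      rewrite Rpower_O by (apply lt_0_INR; lia).
      rewrite !Rpower_1 in * by (apply lt_0_INR; lia). rewrite (S_INR (S k)). lra.
    + specialize (H ltac:(lra) ltac:(lra) ltac:(lra)).
      unfold Rdiv in *. lra.
Qed.

Lemma psum_Rpower_tail (t : R) m d :
  1 < t ->
  psum (fun n => Rpower (INR (S n)) (- t)) (S m + d) <=
  psum (fun n => Rpower (INR (S n)) (- t)) (S m)
  + (Rpower (INR (S m)) (1 - t) - Rpower (INR (S m + d)) (1 - t)) / (t - 1).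
Proof.
  intros Ht. induction d as [|d IH].
  - rewrite Nat.add_0_r. unfold Rdiv. rewrite Rminus_diag. lra.
  - rewrite Nat.add_succ_r.
    change (psum (fun n => Rpower (INR (S n)) (- t)) (S (S m + d))) with
      (psum (fun n => Rpower (INR (S n)) (- t)) (S m + d) + Rpower (INR (S (S m + d))) (- t)).
    assert (Hk : 0 < INR (S m + d)) by (apply lt_0_INR; lia).
    assert (H := Rpower_increment (1 - t) (INR (S m + d)) ltac:(lra) ltac:(lra) Hk).
    rewrite <- (S_INR (S m + d)) in H. replace (1 - t - 1) with (- t) in H by ring.
    set (u := Rpower (INR (S (S m + d))) (1 - t)) in *.
    set (v := Rpower (INR (S m + d)) (1 - t)) in *.
    replace ((u - v) / (1 - t)) with ((v - u) / (t - 1)) in H by (field; lra).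
    set (w := Rpower (INR (S m)) (1 - t)) in *.
    replace ((w - u) / (t - 1)) with ((w - v) / (t - 1) + (v - u) / (t - 1)) by (field; lra).
    lra.
Qed.

Lemma ex_series_Rpower (t : R) : 1 < t -> ex_series (fun n => Rpower (INR (S n)) (- t)).
Proof.
  intros Ht.
  set (a := fun n => Rpower (INR (S n)) (- t)).
  apply (ex_series_bounded _ (psum a 1 + Rpower 1 (1 - t) / (t - 1))).
  - intros n. left. apply exp_pos.
  - intros k. apply Rle_trans with (psum a (1 + k)).
    + apply psum_mono; [|lia]. intros n. left. apply exp_pos.
    + eapply Rle_trans; [apply (psum_Rpower_tail t 0 k Ht)|].
      apply Rplus_le_compat_l. apply Rmult_le_compat_r.
      * left. apply Rinv_0_lt_compat. lra.
      * assert (0 < Rpower (INR (1 + k)) (1 - t)) by apply exp_pos. simpl INR at 1. lra.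
Qed.

Section Dilates.
Context (T : R -> R) (C s t : R).
Hypothesis T_pos : forall z, 0 < z -> 0 < T z.
Hypothesis T_incr : forall y z, 0 < y -> y <= z -> T y <= T z.
Hypothesis T_s : forall z, 0 < z -> T z <= C * Rpower z s.
Hypothesis T_t : forall z, 0 < z -> T z <= C * Rpower z t.
Hypothesis s_bd : 0 <= s < 1.
Hypothesis t_bd : 1 < t.

(** A Riemann sum in disguise: [dilate_sum N / N] samples [T (1 / y)] with mesh [1 / N]. *)
Definition dilate_sum (N : R) : R := Series (fun n => T (N / INR (S n))).

Lemma dilate_pos N n : 0 < N -> 0 < N / INR (S n).
Proof. intros H. apply Rdiv_lt_0_compat; [easy|apply lt_0_INR; lia]. Qed.

Lemma dilate_const_pos : 0 < C.
Proof.
  assert (H := T_s 1 Rlt_0_1). assert (H' := T_pos 1 Rlt_0_1).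
  assert (0 < Rpower 1 s) by apply exp_pos.
  apply Rnot_le_lt. intros HC. nra.
Qed.

Lemma Rpower_div x y e : 0 < x -> 0 < y -> Rpower (x / y) e = Rpower x e * Rpower y (- e).
Proof.
  intros Hx Hy. unfold Rdiv.
  rewrite <- Rpower_mult_distr by (try apply Rinv_0_lt_compat; lra).
  f_equal. unfold Rpower. rewrite ln_Rinv by easy. f_equal. ring.
Qed.

Lemma dilate_bound e N n :
  (forall z, 0 < z -> T z <= C * Rpower z e) -> 0 < N ->
  T (N / INR (S n)) <= C * Rpower N e * Rpower (INR (S n)) (- e).
Proof.
  intros He HN. rewrite Rmult_assoc, <- Rpower_div; [|easy|apply lt_0_INR; lia].
  now apply He, dilate_pos.
Qed.

Lemma ex_dilate_sum N : 0 < N -> ex_series (fun n => T (N / INR (S n))).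
Proof.
  intros HN.
  apply (ex_series_le (V := R_CompleteNormedModule) _
    (fun n => C * Rpower N t * Rpower (INR (S n)) (- t))).
  - intros n. unfold norm; simpl; unfold abs; simpl.
    rewrite Rabs_pos_eq by (left; apply T_pos, dilate_pos, HN).
    now apply dilate_bound.
  - apply (ex_series_scal (V := R_NormedModule) (C * Rpower N t)).
    now apply ex_series_Rpower.
Qed.

Lemma dilate_terms_pos N : 0 < N -> forall n, 0 <= T (N / INR (S n)).
Proof. intros HN n. left. now apply T_pos, dilate_pos. Qed.

Lemma dilate_sum_incr x y : 0 < x -> x <= y -> dilate_sum x <= dilate_sum y.
Proof.
  intros Hx Hxy. apply Series_le; [|apply ex_dilate_sum; lra].
  intros n. split; [now apply dilate_terms_pos|].
  apply T_incr; [now apply dilate_pos|].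
  apply Rmult_le_compat_r; [|easy].
  left. apply Rinv_0_lt_compat, lt_0_INR. lia.
Qed.

Lemma psum_block a K m c :
  (forall n, (K <= n < K + m)%nat -> c <= a n) ->
  psum a K + INR m * c <= psum a (K + m).
Proof.
  intros H. induction m as [|m IH].
  - rewrite Nat.add_0_r. simpl; lra.
  - rewrite Nat.add_succ_r, S_INR. simpl.
    assert (c <= a (K + m)%nat) by (apply H; lia).
    assert (psum a K + INR m * c <= psum a (K + m)) by (apply IH; intros; apply H; lia).
    lra.
Qed.

(** By monotonicity of [T], the [m] terms on the right with indices from [m J] to [m J + m - 1] are
    all at least the term of index [J] on the left. *)
Lemma dilate_sum_superhomogeneous m N : 0 < N -> (0 < m)%nat ->
  INR m * dilate_sum N <= dilate_sum (INR m * N).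
Proof.
  intros HN Hm.
  assert (Hm' : 0 < INR m) by (apply lt_0_INR; lia).
  assert (HmN : 0 < INR m * N) by nra.
  apply (Rmult_le_reg_l (/ INR m)); [now apply Rinv_0_lt_compat|].
  rewrite <- Rmult_assoc, Rinv_l, Rmult_1_l by lra.
  apply Series_le_bound; [now apply ex_dilate_sum|].
  intros J. apply (Rmult_le_reg_l (INR m)); [easy|].
  rewrite <- Rmult_assoc, Rinv_r, Rmult_1_l by lra.
  apply Rle_trans with (psum (fun n => T (INR m * N / INR (S n))) (m * J)).
  - induction J as [|J IH].
    + simpl. rewrite Nat.mul_0_r. simpl. lra.
    + rewrite Nat.mul_succ_r. eapply Rle_trans; [|apply (psum_block _ _ _ (T (N / INR (S J))))].
      * cbn [psum]. lra.
      * intros n Hn. apply T_incr; [now apply dilate_pos|].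
        assert (0 < INR (S n)) by (apply lt_0_INR; lia).
        assert (0 < INR (S J)) by (apply lt_0_INR; lia).
        apply (Rmult_le_reg_r (INR (S n))); [easy|].
        apply (Rmult_le_reg_r (INR (S J))); [easy|].
        replace (N / INR (S J) * INR (S n) * INR (S J)) with (N * INR (S n)) by (field; lra).
        replace (INR m * N / INR (S n) * INR (S n) * INR (S J)) with (N * (INR m * INR (S J)))
          by (field; lra).
        apply Rmult_le_compat_l; [lra|].
        rewrite <- mult_INR. apply le_INR. lia.
  - apply psum_le_Series; [now apply ex_dilate_sum|now apply dilate_terms_pos].
Qed.

(** The sum is cut at index [S m]: the exponent [s < 1] controls the terms before the cut, the
    exponent [t > 1] those after it. *)
Lemma dilate_sum_integer_bound m :
  dilate_sum (INR (S m)) <= C * (/ (1 - s) + / (t - 1)) * INR (S m).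
Proof.
  assert (HC := dilate_const_pos).
  assert (HM : 0 < INR (S m)) by (apply lt_0_INR; lia).
  apply Series_le_bound; [now apply ex_dilate_sum|].
  intros J. apply Rle_trans with (psum (fun n => T (INR (S m) / INR (S n))) (S m + J)).
  { apply psum_mono; [now apply dilate_terms_pos|lia]. }
  set (M := INR (S m)) in *.
  assert (Htail : psum (fun n => T (M / INR (S n))) (S m + J) <=
    psum (fun n => T (M / INR (S n))) (S m) +
    C * Rpower M t * (psum (fun n => Rpower (INR (S n)) (- t)) (S m + J)
        - psum (fun n => Rpower (INR (S n)) (- t)) (S m))).
  { induction J as [|J IH].
    - rewrite Nat.add_0_r, Rminus_diag, Rmult_0_r. lra.
    - rewrite Nat.add_succ_r.
      change (psum (fun n => T (M / INR (S n))) (S (S m + J))) with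
       (psum (fun n => T (M / INR (S n))) (S m + J) + T (M / INR (S (S m + J)))).
      change (psum (fun n => Rpower (INR (S n)) (- t)) (S (S m + J))) with
       (psum (fun n => Rpower (INR (S n)) (- t)) (S m + J) + Rpower (INR (S (S m + J))) (- t)).
      assert (H := dilate_bound t M (S m + J) T_t HM). lra. }
  assert (Hhead : psum (fun n => T (M / INR (S n))) (S m) <=
    C * Rpower M s * psum (fun n => Rpower (INR (S n)) (- s)) (S m)).
  { rewrite <- psum_scal. apply psum_le. intros n _. now apply dilate_bound. }
  assert (H1 := psum_Rpower_head s m s_bd).
  assert (H2 := psum_Rpower_tail t m J t_bd).
  fold M in H1, H2.
  assert (Hs : C * Rpower M s * (Rpower M (1 - s) / (1 - s)) = C * (/ (1 - s)) * M).
  { assert (E : Rpower M s * Rpower M (1 - s) = M).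
    { rewrite <- Rpower_plus. replace (s + (1 - s)) with 1 by ring. now apply Rpower_1. }
    transitivity (C * (/ (1 - s)) * (Rpower M s * Rpower M (1 - s))); [unfold Rdiv; ring|now rewrite E]. }
  assert (Ht : C * Rpower M t * (Rpower M (1 - t) / (t - 1)) = C * (/ (t - 1)) * M).
  { assert (E : Rpower M t * Rpower M (1 - t) = M).
    { rewrite <- Rpower_plus. replace (t + (1 - t)) with 1 by ring. now apply Rpower_1. }
    transitivity (C * (/ (t - 1)) * (Rpower M t * Rpower M (1 - t))); [unfold Rdiv; ring|now rewrite E]. }
  assert (Hps : 0 < C * Rpower M s) by (apply Rmult_lt_0_compat; [easy|apply exp_pos]).
  assert (Hpt : 0 < C * Rpower M t) by (apply Rmult_lt_0_compat; [easy|apply exp_pos]).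
  assert (H3 : (Rpower M (1 - t) - Rpower (INR (S m + J)) (1 - t)) / (t - 1)
      <= Rpower M (1 - t) / (t - 1)).
  { apply Rmult_le_compat_r; [left; apply Rinv_0_lt_compat; lra|].
    assert (0 < Rpower (INR (S m + J)) (1 - t)) by apply exp_pos. lra. }
  assert (H4 := Rmult_le_compat_l _ _ _ (Rlt_le _ _ Hps) H1).
  assert (H5 : C * Rpower M t * (psum (fun n => Rpower (INR (S n)) (- t)) (S m + J)
        - psum (fun n => Rpower (INR (S n)) (- t)) (S m)) <=
     C * Rpower M t * (Rpower M (1 - t) / (t - 1))) by (apply Rmult_le_compat_l; lra).
  rewrite Hs in H4. rewrite Ht in H5. lra.
Qed.

Lemma dilate_sum_linear_bound N : 0 < N ->
  dilate_sum N <= 2 * (C * (/ (1 - s) + / (t - 1))) * N.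
Proof.
  intros HN. set (K := C * (/ (1 - s) + / (t - 1))).
  assert (HK : 0 < K).
  { apply Rmult_lt_0_compat; [apply dilate_const_pos|].
    assert (0 < / (1 - s)) by (apply Rinv_0_lt_compat; lra).
    assert (0 < / (t - 1)) by (apply Rinv_0_lt_compat; lra). lra. }
  (* Superhomogeneity allows passing from [N] to [m N > 1]; rounding that up to an integer at most
     doubles it, whence the factor [2]. *)
  destruct (floor_multiple 1 N) as [m Hm]; [lra|easy|].
  assert (Hm0 : (0 < m)%nat) by (destruct m; [simpl in Hm; lra|lia]).
  assert (Hm' : 0 < INR m) by (apply lt_0_INR; lia).
  destruct (floor_multiple (INR m * N) 1) as [k Hk]; [lra|lra|].
  destruct k as [|k]; [simpl in Hk; lra|].
  assert (H1 := dilate_sum_superhomogeneous m N HN Hm0).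
  assert (H2 := dilate_sum_incr (INR m * N) (INR (S k)) ltac:(lra) ltac:(lra)).
  assert (H3 := dilate_sum_integer_bound k). fold K in H3.
  apply (Rmult_le_reg_l (INR m)); [easy|]. nra.
Qed.

(* The limit is the supremum of [dilate_sum N / N], by superhomogeneity. *)
Lemma dilate_sum_limit :
  exists L, 0 < L /\ forall eps, 0 < eps -> exists X, 0 < X /\
    forall N, X < N -> Rabs (dilate_sum N / N - L) < eps.
Proof.
  destruct (completeness (fun y => exists N, 0 < N /\ y = dilate_sum N / N)) as [L [HL1 HL2]].
  - exists (2 * (C * (/ (1 - s) + / (t - 1)))). intros y [N [HN ->]].
    apply (Rmult_le_reg_r N); [easy|].
    replace (dilate_sum N / N * N) with (dilate_sum N) by (field; lra).
    now apply dilate_sum_linear_bound.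
  - exists (dilate_sum 1 / 1), 1. split; [lra|easy].
  - assert (Hpos : forall N, 0 < N -> 0 < dilate_sum N).
    { intros N HN. apply Rlt_le_trans with (psum (fun n => T (N / INR (S n))) 1).
      - simpl. rewrite Rplus_0_l. apply T_pos, (dilate_pos N 0 HN).
      - apply psum_le_Series; [now apply ex_dilate_sum|now apply dilate_terms_pos]. }
    exists L. split.
    + apply Rlt_le_trans with (dilate_sum 1 / 1).
      * apply Rdiv_lt_0_compat; [apply Hpos|]; lra.
      * apply HL1. exists 1. split; [lra|easy].
    + intros eps Heps.
      assert (HN0 : exists N0, 0 < N0 /\ L - eps / 2 < dilate_sum N0 / N0).
      { apply NNPP. intros Hno. assert (L <= L - eps / 2); [|lra].
        apply HL2. intros y [N [HN ->]]. apply Rnot_lt_le. intros Hlt.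
        apply Hno. now exists N. }
      destruct HN0 as [N0 [HN0 Hl]].
      (* Rounding [N] down to a multiple of [N0] costs at most [dilate_sum N0], which beyond this
         threshold is less than [eps / 2 * N]. *)
      exists (N0 + 2 * dilate_sum N0 / eps).
      assert (Hq : 0 < 2 * dilate_sum N0 / eps).
      { apply Rdiv_lt_0_compat; [|easy]. specialize (Hpos N0 HN0). lra. }
      split; [lra|].
      intros N HN.
      assert (Hup : dilate_sum N / N <= L) by (apply HL1; exists N; split; [lra|easy]).
      assert (Hlow : L - eps < dilate_sum N / N).
      { destruct (floor_multiple (N - N0) N0) as [m Hm]; [lra|easy|].
        assert (Hm0 : (0 < m)%nat) by (destruct m; [simpl in Hm; lra|lia]).
        assert (H1 := dilate_sum_superhomogeneous m N0 HN0 Hm0).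
        assert (H2 := dilate_sum_incr (INR m * N0) N ltac:(nra) ltac:(lra)).
        set (q := dilate_sum N0 / N0) in *.
        assert (Hq0 : dilate_sum N0 = q * N0) by (unfold q; field; lra).
        assert (Hb : dilate_sum N >= (N - N0) * q).
        { assert (0 < q) by (unfold q; apply Rdiv_lt_0_compat; auto). rewrite Hq0 in H1. nra. }
        assert (Hc : eps / 2 * N > dilate_sum N0).
        { assert (E : 2 * dilate_sum N0 / eps * (eps / 2) = dilate_sum N0) by (field; lra). nra. }
        apply (Rmult_lt_reg_r N); [lra|].
        replace (dilate_sum N / N * N) with (dilate_sum N) by (field; lra).
        nra. }
      apply Rabs_def1; lra.
Qed.

End Dilates.

(** * Powers of the integers, and limits at infinity *)

Definition power_seq (beta : R) (n : nat) : R := Rpower (INR (S n)) beta.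

Lemma power_seq_pos beta n : 0 < power_seq beta n.
Proof. apply exp_pos. Qed.

Lemma Rpower_pow_mult x e k : (Rpower x e) ^ k = Rpower x (e * INR k).
Proof.
  rewrite <- Rpower_pow by apply exp_pos. apply Rpower_mult.
Qed.

Lemma ex_series_inv_pow beta p :
  1 < beta * INR (S p) -> ex_series (fun n => / power_seq beta n ^ S p).
Proof.
  intros H. apply (ex_series_ext (fun n => Rpower (INR (S n)) (- (beta * INR (S p))))).
  - intros n. unfold power_seq. now rewrite Rpower_pow_mult, Rpower_Ropp.
  - now apply ex_series_Rpower.
Qed.

(** Spelled out with real quantifiers so that [dfn_tends_to] can read it as a formula. The condition
    [0 < X] confines attention to positive arguments, where the primitives live. *)
Definition tends_to (f : R -> R) (l : R) : Prop :=
  forall eps, 0 < eps -> exists X, 0 < X /\ forall x, X < x -> Rabs (f x - l) < eps.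

Lemma tends_to_ext f g l :
  (forall x, 0 < x -> f x = g x) -> tends_to f l -> tends_to g l.
Proof.
  intros H Hf eps Heps. destruct (Hf eps Heps) as [X [HX HfX]].
  exists X. split; [easy|]. intros x Hx. rewrite <- H by lra. auto.
Qed.

Lemma tends_to_plus f g l m :
  tends_to f l -> tends_to g m -> tends_to (fun x => f x + g x) (l + m).
Proof.
  intros Hf Hg eps Heps.
  destruct (Hf (eps / 2) ltac:(lra)) as [X [HX HfX]].
  destruct (Hg (eps / 2) ltac:(lra)) as [Y [HY HgY]].
  exists (X + Y). split; [lra|]. intros x Hx.
  specialize (HfX x ltac:(lra)). specialize (HgY x ltac:(lra)).
  apply Rabs_def2 in HfX, HgY. apply Rabs_def1; lra.
Qed.

Lemma tends_to_scal c f l : tends_to f l -> tends_to (fun x => c * f x) (c * l).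
Proof.
  intros Hf eps Heps.
  assert (Hc : 0 < Rabs c + 1) by (assert (0 <= Rabs c) by apply Rabs_pos; lra).
  destruct (Hf (eps / (Rabs c + 1))) as [X [HX HfX]].
  { now apply Rdiv_lt_0_compat. }
  exists X. split; [easy|]. intros x Hx. specialize (HfX x Hx).
  rewrite <- Rmult_minus_distr_l, Rabs_mult.
  assert (E : eps = eps / (Rabs c + 1) * (Rabs c + 1)) by (field; lra).
  assert (0 <= Rabs (f x - l)) by apply Rabs_pos.
  assert (0 <= Rabs c) by apply Rabs_pos. nra.
Qed.

Lemma tends_to_minus f g l m :
  tends_to f l -> tends_to g m -> tends_to (fun x => f x - g x) (l - m).
Proof.
  intros Hf Hg.
  apply (tends_to_ext (fun x => f x + (-1) * g x)); [intros; ring|].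
  replace (l - m) with (l + (-1) * m) by ring.
  now apply tends_to_plus, tends_to_scal.
Qed.

Lemma tends_to_dilate c f l : 0 < c -> tends_to f l -> tends_to (fun x => f (c * x)) l.
Proof.
  intros Hc Hf eps Heps. destruct (Hf eps Heps) as [X [HX HfX]].
  exists (X / c). split; [now apply Rdiv_lt_0_compat|].
  intros x Hx. apply HfX. apply (Rmult_lt_reg_r (/ c)); [now apply Rinv_0_lt_compat|].
  replace (c * x * / c) with x by (field; lra). exact Hx.
Qed.

Lemma tends_to_le f g l m :
  (forall x, 0 < x -> f x <= g x) -> tends_to f l -> tends_to g m -> l <= m.
Proof.
  intros H Hf Hg. apply Rnot_lt_le. intros Hlt.
  destruct (Hf ((l - m) / 2) ltac:(lra)) as [X [HX HfX]].
  destruct (Hg ((l - m) / 2) ltac:(lra)) as [Y [HY HgY]].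
  specialize (HfX (X + Y + 1) ltac:(lra)). specialize (HgY (X + Y + 1) ltac:(lra)).
  specialize (H (X + Y + 1) ltac:(lra)).
  apply Rabs_def2 in HfX, HgY. lra.
Qed.

Lemma tends_to_unique f l m : tends_to f l -> tends_to f m -> l = m.
Proof.
  intros H1 H2. apply Rle_antisym; eapply tends_to_le; eauto; intros; lra.
Qed.

Lemma tends_to_div f g l m :
  m <> 0 -> tends_to f l -> tends_to g m -> tends_to (fun x => f x / g x) (l / m).
Proof.
  intros Hm Hf Hg eps Heps.
  assert (Hm' : 0 < Rabs m) by now apply Rabs_pos_lt.
  set (d := eps * Rabs m * Rabs m / (4 * (Rabs m + Rabs l + 1))).
  assert (Hl : 0 <= Rabs l) by apply Rabs_pos.
  assert (Hd : 0 < d).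
  { unfold d. apply Rdiv_lt_0_compat; [|lra].
    apply Rmult_lt_0_compat; [apply Rmult_lt_0_compat|]; lra. }
  destruct (Hf d Hd) as [X [HX HfX]].
  destruct (Hg (Rmin d (Rabs m / 2))) as [Y [HY HgY]].
  { apply Rmin_glb_lt; lra. }
  exists (X + Y). split; [lra|]. intros x Hx.
  specialize (HfX x ltac:(lra)). specialize (HgY x ltac:(lra)).
  assert (HgY1 := Rlt_le_trans _ _ _ HgY (Rmin_l _ _)).
  assert (HgY2 := Rlt_le_trans _ _ _ HgY (Rmin_r _ _)).
  assert (Hgx : Rabs m / 2 < Rabs (g x)).
  { assert (H := Rabs_triang_inv m (m - g x)).
    replace (m - (m - g x)) with (g x) in H by ring.
    rewrite (Rabs_minus_sym m) in H. lra. }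
  assert (Hgx0 : g x <> 0) by (intros E; rewrite E, Rabs_R0 in Hgx; lra).
  replace (f x / g x - l / m) with (((f x - l) * m - l * (g x - m)) / (g x * m))
    by (field; easy).
  rewrite Rabs_div by (now apply Rmult_integral_contrapositive). rewrite (Rabs_mult (g x)).
  assert (Hnum : Rabs ((f x - l) * m - l * (g x - m)) <= d * (Rabs m + Rabs l)).
  { eapply Rle_trans; [apply Rabs_triang|]. rewrite Rabs_Ropp, !Rabs_mult.
    assert (0 <= Rabs (f x - l)) by apply Rabs_pos.
    assert (0 <= Rabs (g x - m)) by apply Rabs_pos. nra. }
  apply (Rmult_lt_reg_r (Rabs (g x) * Rabs m)); [nra|].
  unfold Rdiv. rewrite Rmult_assoc, Rinv_l by nra. rewrite Rmult_1_r.
  apply Rle_lt_trans with (d * (Rabs m + Rabs l)); [easy|].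
  apply Rlt_trans with (eps * Rabs m * Rabs m / 2).
  - assert (E : d * (4 * (Rabs m + Rabs l + 1)) = eps * Rabs m * Rabs m).
    { unfold d. field. lra. }
    assert (0 < d * (Rabs m + Rabs l)) by nra. nra.
  - assert (0 < eps * Rabs m) by nra. nra.
Qed.

(** * Asymptotics of kernel sums over the powers [n ^ beta] *)

Section CanonicalSums.
Context (beta : R) (beta_pos : 0 < beta).

Definition csum (T : R -> R) (x : R) : R :=
  Series (fun n => T (x / power_seq beta n)).

Lemma div_power_seq_pos x n : 0 < x -> 0 < x / power_seq beta n.
Proof. intros H. apply Rdiv_lt_0_compat; [easy|apply power_seq_pos]. Qed.

Lemma ex_csum T C p x :
  1 < beta * INR (S p) -> 0 < x -> (forall u, 0 < u -> 0 <= T u <= C * u ^ S p) ->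
  ex_series (fun n => T (x / power_seq beta n)).
Proof.
  intros Hp Hx HT.
  apply (ex_series_le (V := R_CompleteNormedModule) _
    (fun n => C * x ^ S p * / power_seq beta n ^ S p)).
  - intros n. unfold norm; simpl; unfold abs; simpl.
    specialize (HT _ (div_power_seq_pos x n Hx)).
    rewrite Rabs_pos_eq by apply HT.
    replace (C * (x * x ^ p) * / (power_seq beta n * power_seq beta n ^ p)) with
     (C * (x / power_seq beta n) ^ S p); [apply HT|].
    unfold Rdiv. rewrite Rpow_mult_distr, pow_inv. simpl. ring.
  - apply (ex_series_scal (V := R_NormedModule) (C * x ^ S p)).
    now apply ex_series_inv_pow.
Qed.

(** With [x = N ^ beta] the sum becomes the [dilate_sum] of [z -> T (z ^ beta)] at [N]; the two
    bounds on [T] provide exponents on both sides of [1]. *)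
Lemma csum_limit T C (q q' : nat) :
  beta * INR q < 1 -> 1 < beta * INR q' ->
  (forall u, 0 < u -> 0 < T u) ->
  (forall u v, 0 < u -> u <= v -> T u <= T v) ->
  (forall u, 0 < u -> T u <= C * u ^ q) ->
  (forall u, 0 < u -> T u <= C * u ^ q') ->
  exists L, 0 < L /\ tends_to (fun x => csum T x / Rpower x (1 / beta)) L.
Proof.
  intros Hq Hq' Hpos Hincr Hb Hb'.
  destruct (dilate_sum_limit (fun z => T (Rpower z beta)) C (beta * INR q) (beta * INR q'))
    as [L [HL Hlim]].
  - intros z Hz. apply Hpos, exp_pos.
  - intros y z Hy Hyz. apply Hincr; [apply exp_pos|]. apply Rle_Rpower_l; lra.
  - intros z Hz. rewrite <- Rpower_pow_mult. apply Hb, exp_pos.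
  - intros z Hz. rewrite <- Rpower_pow_mult. apply Hb', exp_pos.
  - split; [|easy]. apply Rmult_le_pos; [lra|apply pos_INR].
  - easy.
  - exists L. split; [easy|]. intros eps Heps.
    destruct (Hlim eps Heps) as [X [HX H]].
    exists (Rpower X beta). split; [apply exp_pos|]. intros x Hx.
    assert (Hx0 : 0 < x) by (apply Rlt_trans with (2 := Hx), exp_pos).
    assert (HN : X < Rpower x (1 / beta)).
    { replace X with (Rpower (Rpower X beta) (1 / beta)).
      - apply Rlt_Rpower_l; [now apply Rdiv_lt_0_compat; lra|].
        split; [apply exp_pos|easy].
      - rewrite Rpower_mult. replace (beta * (1 / beta)) with 1 by (field; lra).
        now apply Rpower_1. }
    specialize (H _ HN).
    replace (csum T x) with (dilate_sum (fun z => T (Rpower z beta)) (Rpower x (1 / beta)));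
      [easy|].
    apply Series_ext. intros n. f_equal. unfold power_seq.
    rewrite Rpower_div; [|apply exp_pos|apply lt_0_INR; lia].
    rewrite Rpower_mult. replace (1 / beta * beta) with 1 by (field; lra).
    now rewrite Rpower_1, Rpower_Ropp.
Qed.

Lemma frac_mono u v : 0 < u -> u <= v -> 0 < u / (1 + u) <= v / (1 + v).
Proof.
  intros Hu Huv. split; [apply Rdiv_lt_0_compat; lra|].
  apply (Rmult_le_reg_r ((1 + u) * (1 + v))); [nra|].
  replace (u / (1 + u) * ((1 + u) * (1 + v))) with (u * (1 + v)) by (field; lra).
  replace (v / (1 + v) * ((1 + u) * (1 + v))) with (v * (1 + u)) by (field; lra).
  nra.
Qed.

Lemma frac_bounds u : 0 < u -> 0 < u / (1 + u) /\ u / (1 + u) <= u /\ u / (1 + u) <= 1.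
Proof.
  intros Hu. repeat split.
  - apply Rdiv_lt_0_compat; lra.
  - apply div_le_l; lra.
  - apply (Rmult_le_reg_r (1 + u)); [lra|]. unfold Rdiv. rewrite Rmult_assoc, Rinv_l; lra.
Qed.

(* [kern p u = (p + 1) u^p w - u^p w^2] with [w = u / (1 + u)]: both summands
   are increasing, although [kern 0] is not. *)
Lemma csum_kern_limit p :
  beta * INR p < 1 -> 1 < beta * INR (S p) ->
  exists L, 0 < L /\ tends_to (fun x => csum (kern p) x / Rpower x (1 / beta)) L.
Proof.
  intros Hp Hp'.
  set (T1 := fun u => u ^ p * (u / (1 + u))).
  set (T2 := fun u => u ^ p * (u / (1 + u)) ^ 2).
  assert (Hpp : forall u, 0 < u -> 0 < u ^ p) by (intros u Hu; now apply pow_lt).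
  assert (Hinc : forall u v, 0 < u -> u <= v -> u ^ p <= v ^ p)
    by (intros u v Hu Huv; apply pow_incr; lra).
  assert (B1 : forall u, 0 < u -> 0 < T1 u /\ T1 u <= 1 * u ^ p /\ T1 u <= 1 * u ^ S p).
  { intros u Hu. unfold T1. simpl. specialize (Hpp u Hu).
    destruct (frac_bounds u Hu) as [W1 [W2 W3]]. repeat split; nra. }
  assert (B2 : forall u, 0 < u -> 0 < T2 u /\ T2 u <= 1 * u ^ p /\ T2 u <= 1 * u ^ S p).
  { intros u Hu. unfold T2. simpl. specialize (Hpp u Hu).
    destruct (frac_bounds u Hu) as [W1 [W2 W3]]. set (w := u / (1 + u)) in *.
    assert (0 < w * (w * 1) <= w) by nra. repeat split; nra. }
  destruct (csum_limit T1 1 p (S p) Hp Hp') as [L1 [HL1 Hlim1]].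
  { intros u Hu. now apply B1. }
  { intros u v Hu Huv. unfold T1. specialize (Hinc u v Hu Huv). specialize (Hpp u Hu).
    destruct (frac_mono u v Hu Huv). apply Rmult_le_compat; lra. }
  { intros u Hu. now apply B1. }
  { intros u Hu. now apply B1. }
  destruct (csum_limit T2 1 p (S p) Hp Hp') as [L2 [HL2 Hlim2]].
  { intros u Hu. now apply B2. }
  { intros u v Hu Huv. unfold T2. specialize (Hinc u v Hu Huv). specialize (Hpp u Hu).
    destruct (frac_mono u v Hu Huv). apply Rmult_le_compat; [lra|apply pow2_ge_0|lra|].
    apply pow_incr; lra. }
  { intros u Hu. now apply B2. }
  { intros u Hu. now apply B2. }
  assert (E1 : forall x, 0 < x -> ex_series (fun n => T1 (x / power_seq beta n))).
  { intros x Hx. apply (ex_csum T1 1 p x Hp' Hx). intros u Hu. specialize (B1 u Hu). lra. }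
  assert (E2 : forall x, 0 < x -> ex_series (fun n => T2 (x / power_seq beta n))).
  { intros x Hx. apply (ex_csum T2 1 p x Hp' Hx). intros u Hu. specialize (B2 u Hu). lra. }
  exists (INR (S p) * L1 - L2). split.
  - (* [T2 u <= 2 ^ p * T1 (u / 2)], and halving [x] divides the limit by
       [2 ^ (1 / beta) > 2 ^ p]. *)
    assert (Hrho : 1 / beta > INR p).
    { apply (Rmult_lt_reg_l beta); [easy|]. replace (beta * (1 / beta)) with 1 by (field; lra). lra. }
    assert (Hle : L2 <= 2 ^ p * / Rpower 2 (1 / beta) * L1).
    { apply (tends_to_le (fun x => csum T2 x / Rpower x (1 / beta))
        (fun x => 2 ^ p * / Rpower 2 (1 / beta) *
          (csum T1 (/ 2 * x) / Rpower (/ 2 * x) (1 / beta)))).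
      - intros x Hx.
        replace (Rpower x (1 / beta)) with (Rpower 2 (1 / beta) * Rpower (/ 2 * x) (1 / beta)).
        2:{ rewrite Rpower_mult_distr by lra. f_equal. lra. }
        assert (H1 : 0 < Rpower 2 (1 / beta)) by apply exp_pos.
        assert (H2 : 0 < Rpower (/ 2 * x) (1 / beta)) by apply exp_pos.
        replace (2 ^ p * / Rpower 2 (1 / beta) *
          (csum T1 (/ 2 * x) / Rpower (/ 2 * x) (1 / beta))) with
          (2 ^ p * csum T1 (/ 2 * x) / (Rpower 2 (1 / beta) * Rpower (/ 2 * x) (1 / beta)))
          by (field; lra).
        apply Rmult_le_compat_r; [left; apply Rinv_0_lt_compat; nra|].
        unfold csum. rewrite <- Series_scal_l. apply Series_le.
        + intros n. assert (Hu := div_power_seq_pos x n Hx).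
          split; [left; now apply B2|].
          replace (/ 2 * x / power_seq beta n) with (/ 2 * (x / power_seq beta n))
            by (unfold Rdiv; ring).
          set (u := x / power_seq beta n) in *. unfold T1, T2.
          rewrite Rpow_mult_distr.
          replace (2 ^ p * ((/ 2) ^ p * u ^ p * (/ 2 * u / (1 + / 2 * u)))) with
            (u ^ p * (u / (2 + u))).
          2:{ rewrite <- (Rmult_1_l (u ^ p)) at 1. rewrite <- (pow1 p) at 1.
              replace 1 with (2 * / 2) by lra. rewrite Rpow_mult_distr. field. lra. }
          apply Rmult_le_compat_l; [left; now apply Hpp|].
          apply (Rmult_le_reg_r ((1 + u) ^ 2 * (2 + u))); [simpl; nra|].
          replace ((u / (1 + u)) ^ 2 * ((1 + u) ^ 2 * (2 + u))) with (u ^ 2 * (2 + u))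
            by (field; lra).
          replace (u / (2 + u) * ((1 + u) ^ 2 * (2 + u))) with (u * (1 + u) ^ 2)
            by (field; lra).
          simpl. nra.
        + apply (ex_series_scal (V := R_NormedModule) (2 ^ p)), E1. lra.
      - exact Hlim2.
      - apply tends_to_scal.
        apply (tends_to_dilate (/ 2) (fun x => csum T1 x / Rpower x (1 / beta))); [lra|easy]. }
    assert (Hlt : 2 ^ p * / Rpower 2 (1 / beta) < 1).
    { rewrite <- Rpower_pow by lra.
      apply (Rmult_lt_reg_r (Rpower 2 (1 / beta))); [apply exp_pos|].
      rewrite Rmult_assoc, Rinv_l, Rmult_1_r, Rmult_1_l
        by (apply Rgt_not_eq, exp_pos).
      apply Rpower_lt; lra. }
    rewrite S_INR. assert (0 <= INR p) by apply pos_INR. nra.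
  - apply (tends_to_ext (fun x => INR (S p) * (csum T1 x / Rpower x (1 / beta))
        - csum T2 x / Rpower x (1 / beta))).
    + intros x Hx. replace (csum (kern p) x) with (INR (S p) * csum T1 x - csum T2 x).
      { unfold Rdiv; ring. }
      unfold csum. rewrite <- Series_scal_l, <- Series_minus.
      * apply Series_ext. intros n. assert (Hu := div_power_seq_pos x n Hx).
        revert Hu. generalize (x / power_seq beta n). intros u Hu.
        unfold kern, T1, T2. rewrite S_INR. simpl. field. lra.
      * apply (ex_series_scal (V := R_NormedModule) (INR (S p))), E1, Hx.
      * apply E2, Hx.
    + apply tends_to_minus; [|easy]. now apply tends_to_scal.
Qed.

(* For [k beta = 1] the sum of the main term [k u^(k+1) / (1 + u)] of [kern k]
   is of order [x^k ln x], so [csum_limit] applies only to its dilation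
   increments. *)
Lemma csum_kern_increment_limit k c :
  beta * INR (S k) = 1 -> 1 < c ->
  exists L, 0 < L /\
    tends_to (fun x => csum (kern (S k)) (c * x) / (c * x) ^ S k - csum (kern (S k)) x / x ^ S k) L.
Proof.
  intros Hk Hc.
  assert (Hq : beta * INR k < 1) by (rewrite S_INR in Hk; nra).
  assert (Hq' : 1 < beta * INR (S (S k))) by (rewrite (S_INR (S k)); nra).
  assert (Hrho : forall x, 0 < x -> Rpower x (1 / beta) = x ^ S k).
  { intros x Hx. rewrite <- Rpower_pow by easy. f_equal.
    apply (Rmult_eq_reg_l beta); [|lra]. rewrite Hk. field. lra. }
  (* [kern (S k)] is [(k + 1) T1 + T3]. At infinity [T1] grows at exactly the borderline rate
     [u ^ (k + 1)], and [T3] only like [u ^ k]. *)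
  set (T1 := fun u => u ^ S k * (u / (1 + u))).
  set (T3 := fun u => u ^ k * (u / (1 + u)) ^ 2).
  (* [V u] is [T1 (c u) / c ^ (k + 1) - T1 u]: the leading growth cancels, leaving order [u ^ k]. It
     is written as a product of increasing factors so that its monotonicity is visible. *)
  set (V := fun u => u ^ k * ((c - 1) * (u / (1 + u) * (c * u / (1 + c * u))) / c)).
  assert (Hpp : forall u, 0 < u -> 0 < u ^ k) by (intros u Hu; now apply pow_lt).
  assert (Hinc : forall u v, 0 < u -> u <= v -> u ^ k <= v ^ k)
    by (intros u v Hu Huv; apply pow_incr; lra).
  assert (B1 : forall u, 0 < u -> 0 < T1 u /\ T1 u <= 1 * u ^ S (S k)).
  { intros u Hu. unfold T1. simpl. specialize (Hpp u Hu).
    destruct (frac_bounds u Hu) as [W1 [W2 W3]].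
    assert (0 < u * u ^ k) by nra. split; nra. }
  assert (B3 : forall u, 0 < u -> 0 < T3 u /\ T3 u <= 1 * u ^ k /\ T3 u <= 1 * u ^ S (S k)).
  { intros u Hu. unfold T3. simpl. specialize (Hpp u Hu).
    destruct (frac_bounds u Hu) as [W1 [W2 W3]]. set (w := u / (1 + u)) in *.
    assert (0 < w * (w * 1) <= 1) by nra. assert (w * (w * 1) <= u * u) by nra.
    repeat split; nra. }
  assert (BV : forall u, 0 < u -> 0 < V u /\ V u <= (c - 1) * u ^ k /\ V u <= (c - 1) * u ^ S (S k)).
  { intros u Hu. unfold V. simpl. specialize (Hpp u Hu).
    destruct (frac_bounds u Hu) as [W1 [W2 W3]].
    destruct (frac_bounds (c * u) ltac:(nra)) as [X1 [X2 X3]].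
    set (w := u / (1 + u)) in *. set (y := c * u / (1 + c * u)) in *.
    set (z := (c - 1) * (w * y) / c).
    assert (Ez : z * c = (c - 1) * (w * y)) by (unfold z; field; lra).
    assert (Hwy : 0 < w * y) by nra.
    assert (Hwy1 : w * y <= 1) by nra. assert (Hwy2 : w * y <= c * (u * u)) by nra.
    assert (0 < z) by (unfold z; apply Rdiv_lt_0_compat; nra).
    assert (Hz1 : z <= c - 1) by nra.
    assert (Hz2 : z <= (c - 1) * (u * u)).
    { apply (Rmult_le_reg_r c); [lra|]. nra. }
    repeat split; nra. }
  destruct (csum_limit T3 1 k (S (S k)) Hq Hq') as [L3 [HL3 Hlim3]].
  { intros u Hu. now apply B3. }
  { intros u v Hu Huv. unfold T3. specialize (Hinc u v Hu Huv). specialize (Hpp u Hu).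
    destruct (frac_mono u v Hu Huv). apply Rmult_le_compat; [lra|apply pow2_ge_0|lra|].
    apply pow_incr; lra. }
  { intros u Hu. now apply B3. }
  { intros u Hu. now apply B3. }
  destruct (csum_limit V (c - 1) k (S (S k)) Hq Hq') as [LV [HLV HlimV]].
  { intros u Hu. now apply BV. }
  { intros u v Hu Huv. unfold V. specialize (Hinc u v Hu Huv). specialize (Hpp u Hu).
    destruct (frac_mono u v Hu Huv). destruct (frac_mono (c * u) (c * v) ltac:(nra) ltac:(nra)).
    assert (u / (1 + u) * (c * u / (1 + c * u)) <= v / (1 + v) * (c * v / (1 + c * v)))
      by (apply Rmult_le_compat; lra).
    assert (0 < u / (1 + u) * (c * u / (1 + c * u))) by (apply Rmult_lt_0_compat; lra).
    apply Rmult_le_compat; [lra| |lra|].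
    - apply Rdiv_le_0_compat; [|lra]. nra.
    - apply Rmult_le_compat_r; [left; apply Rinv_0_lt_compat; lra|]. nra. }
  { intros u Hu. now apply BV. }
  { intros u Hu. now apply BV. }
  assert (E1 : forall x, 0 < x -> ex_series (fun n => T1 (x / power_seq beta n))).
  { intros x Hx. apply (ex_csum T1 1 (S k) x Hq' Hx). intros u Hu. specialize (B1 u Hu). lra. }
  assert (E3 : forall x, 0 < x -> ex_series (fun n => T3 (x / power_seq beta n))).
  { intros x Hx. apply (ex_csum T3 1 (S k) x Hq' Hx). intros u Hu. specialize (B3 u Hu). lra. }
  assert (HA : forall x, 0 < x -> csum (kern (S k)) x = INR (S k) * csum T1 x + csum T3 x).
  { intros x Hx. unfold csum. rewrite <- Series_scal_l, <- Series_plus.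
    - apply Series_ext. intros n. assert (Hu := div_power_seq_pos x n Hx).
      revert Hu. generalize (x / power_seq beta n). intros u Hu.
      unfold kern, T1, T3. rewrite (S_INR (S k)). simpl pow. field. lra.
    - apply (ex_series_scal (V := R_NormedModule) (INR (S k))), E1, Hx.
    - apply E3, Hx. }
  assert (HV : forall x, 0 < x -> csum T1 (c * x) = c ^ S k * (csum T1 x + csum V x)).
  { intros x Hx. unfold csum. rewrite <- Series_plus, <- Series_scal_l.
    - apply Series_ext. intros n. assert (Hu := div_power_seq_pos x n Hx).
      replace (c * x / power_seq beta n) with (c * (x / power_seq beta n))
        by (unfold Rdiv; ring).
      revert Hu. generalize (x / power_seq beta n). intros u Hu. unfold T1, V.
      rewrite Rpow_mult_distr. simpl. field. repeat split; nra.
    - apply E1, Hx.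
    - apply (ex_csum V (c - 1) (S k) x Hq' Hx). intros u Hu. specialize (BV u Hu). lra. }
  (* Dilation does not change the limit of the [T3] part, which therefore cancels; positivity comes
     from [V] alone. *)
  exists (INR (S k) * LV + (L3 - L3)). split.
  - assert (0 < INR (S k)) by (apply lt_0_INR; lia). nra.
  - apply (tends_to_ext (fun x => INR (S k) * (csum V x / Rpower x (1 / beta)) +
      (csum T3 (c * x) / Rpower (c * x) (1 / beta) - csum T3 x / Rpower x (1 / beta)))).
    + intros x Hx. assert (Hcx : 0 < c * x) by nra.
      rewrite !Hrho, !HA, HV by easy. rewrite Rpow_mult_distr.
      assert (0 < x ^ S k) by now apply pow_lt.
      assert (0 < c ^ S k) by (apply pow_lt; lra).
      field. lra.
    + apply tends_to_plus; [now apply tends_to_scal|].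
      apply tends_to_minus; [|easy].
      apply (tends_to_dilate c (fun x => csum T3 x / Rpower x (1 / beta))); [lra|easy].
Qed.

End CanonicalSums.

(** * The period group of the product with geometric zeros *)

Section Moments.
Context (L : (R -> R) -> R) (K : R).
Definition bdd (q : R -> R) : Prop := exists B, forall y, 0 < y < 1 -> Rabs (q y) <= B.
Hypothesis L_add : forall p q, bdd p -> bdd q -> L (fun y => p y + q y) = L p + L q.
Hypothesis L_scal : forall c q, bdd q -> L (fun y => c * q y) = c * L q.
Hypothesis L_mono : forall p q, bdd p -> bdd q ->
  (forall y, 0 < y < 1 -> p y <= q y) -> L p <= L q.
(** The right-hand side is [K] times the Lebesgue integral of the same kernel over [(0, 1)]. *)
Hypothesis L_kernel : forall s, 0 <= s <= 1 -> L (fun y => / (1 + s * y) ^ 2) = K / (1 + s).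

Lemma bdd_add p q : bdd p -> bdd q -> bdd (fun y => p y + q y).
Proof.
  intros [B HB] [C HC]. exists (B + C). intros y Hy.
  eapply Rle_trans; [apply Rabs_triang|]. specialize (HB y Hy). specialize (HC y Hy). lra.
Qed.

Lemma bdd_mul p q : bdd p -> bdd q -> bdd (fun y => p y * q y).
Proof.
  intros [B HB] [C HC]. exists (B * C). intros y Hy. rewrite Rabs_mult.
  apply Rmult_le_compat; auto using Rabs_pos.
Qed.

Lemma bdd_scal c q : bdd q -> bdd (fun y => c * q y).
Proof. apply (bdd_mul (fun _ => c)). exists (Rabs c). intros; lra. Qed.

Lemma bdd_id : bdd (fun y => y).
Proof. exists 1. intros y Hy. rewrite Rabs_pos_eq; lra. Qed.

Lemma bdd_pow p k : bdd p -> bdd (fun y => p y ^ k).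
Proof.
  intros Hp. induction k as [|k IH]; simpl.
  - exists 1. intros y _. rewrite Rabs_R1. lra.
  - now apply bdd_mul.
Qed.

Lemma bdd_bernstein i j : bdd (fun y => y ^ i * (1 - y) ^ j).
Proof.
  apply bdd_mul; [apply bdd_pow, bdd_id|].
  apply (bdd_pow (fun y => 1 - y)). exists 1. intros y Hy. rewrite Rabs_pos_eq; lra.
Qed.

Lemma bdd_kernel s : 0 <= s -> bdd (fun y => / (1 + s * y) ^ 2).
Proof.
  intros Hs. exists 1. intros y Hy. assert (0 <= s * y) by nra.
  rewrite Rabs_pos_eq.
  - rewrite <- Rinv_1 at 2. apply Rinv_le_contravar; simpl; nra.
  - left. apply Rinv_0_lt_compat. simpl; nra.
Qed.

Fixpoint kernel_taylor (k : nat) (u : R) : R :=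
  match k with
  | O => 1
  | S j => kernel_taylor j u + (-1) ^ k * INR (S k) * u ^ k
  end.

Lemma kernel_taylor_eq k u :
  (1 + u) ^ 2 * kernel_taylor k u =
  1 + (-1) ^ k * (INR (S (S k)) * u ^ S k + INR (S k) * u ^ S (S k)).
Proof.
  induction k as [|k IH].
  - simpl. ring.
  - cbn [kernel_taylor]. rewrite Rmult_plus_distr_l, IH.
    rewrite (S_INR (S (S k))), (S_INR (S k)). simpl pow. ring.
Qed.

Lemma kernel_taylor_rem k u : 0 <= u <= 1 ->
  Rabs (/ (1 + u) ^ 2 - kernel_taylor k u) <= (2 * INR k + 3) * u ^ S k.
Proof.
  intros Hu. assert (Hd : 1 <= (1 + u) ^ 2) by (simpl; nra).
  assert (Hk := pos_INR k).
  replace (/ (1 + u) ^ 2 - kernel_taylor k u) with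
    ((-1) ^ S k * ((INR (S (S k)) * u ^ S k + INR (S k) * u ^ S (S k)) / (1 + u) ^ 2)).
  - assert (H0 : 0 <= u ^ S k) by (apply pow_le; lra).
    assert (H1 : 0 <= u ^ S (S k) <= u ^ S k).
    { split; [apply pow_le; lra|].
      rewrite <- (tech_pow_Rmult u (S k)). nra. }
    rewrite !S_INR.
    assert (0 <= (INR k + 1 + 1) * u ^ S k + (INR k + 1) * u ^ S (S k)) by nra.
    rewrite Rabs_sign_mul by (apply Rdiv_le_0_compat; lra).
    eapply Rle_trans; [apply div_le_l; lra|]. nra.
  - apply (Rmult_eq_reg_l ((1 + u) ^ 2)); [|lra].
    rewrite Rmult_minus_distr_l, kernel_taylor_eq, Rinv_r by lra.
    simpl pow. field. simpl in Hd. nra.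
Qed.

Fixpoint inv_taylor (k : nat) (s : R) : R :=
  match k with O => 1 | S j => inv_taylor j s + (-1) ^ k * s ^ k end.

Lemma inv_taylor_eq k s : 0 <= s -> / (1 + s) - inv_taylor k s = (-1) ^ S k * s ^ S k / (1 + s).
Proof.
  intros Hs. induction k as [|k IH].
  - simpl. field. lra.
  - cbn [inv_taylor].
    replace (/ (1 + s) - (inv_taylor k s + (-1) ^ S k * s ^ S k)) with
      ((/ (1 + s) - inv_taylor k s) - (-1) ^ S k * s ^ S k) by ring.
    rewrite IH. simpl. field. lra.
Qed.

Lemma le_linear_eq_0 (x C : R) : (forall s, 0 < s <= 1 -> Rabs x <= C * s) -> x = 0.
Proof.
  intros H. apply NNPP. intros Hx. assert (Hp := Rabs_pos_lt x Hx).
  assert (HC : 0 < C) by (specialize (H 1 ltac:(lra)); lra).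
  set (s := Rabs x / (2 * C + Rabs x)).
  assert (Hs : 0 < s <= 1).
  { unfold s. split; [apply Rdiv_lt_0_compat; lra|].
    apply (Rmult_le_reg_r (2 * C + Rabs x)); [lra|].
    unfold Rdiv. rewrite Rmult_assoc, Rinv_l; lra. }
  specialize (H s Hs).
  assert (E : s * (2 * C + Rabs x) = Rabs x) by (unfold s; field; lra).
  nra.
Qed.

Lemma bdd_kernel_taylor k s : bdd (fun y => kernel_taylor k (s * y)).
Proof.
  induction k as [|k IH].
  - exists 1. intros y _. simpl. rewrite Rabs_R1. lra.
  - apply bdd_add; [exact IH|].
    apply (bdd_scal ((-1) ^ S k * INR (S (S k))) (fun y => (s * y) ^ S k)).
    apply (bdd_pow (fun y => s * y)), bdd_scal, bdd_id.
Qed.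

Lemma L_ext p q : bdd p -> bdd q -> (forall y, 0 < y < 1 -> p y = q y) -> L p = L q.
Proof.
  intros Hp Hq H. apply Rle_antisym; apply L_mono; auto; intros y Hy; rewrite H; lra.
Qed.

(** Both sides of [L_kernel] are expanded in powers of [s] and the coefficients compared. Positivity
    of [L] turns the pointwise Taylor remainder into one of order [s ^ (k + 1)]. *)
Lemma moment_eq k : INR (S k) * L (fun y => y ^ k) = K.
Proof.
  assert (H1b : bdd (fun _ => 1)) by (exists 1; intros; rewrite Rabs_R1; lra).
  assert (H1 : L (fun _ => 1) = K).
  { transitivity (L (fun y => / (1 + 0 * y) ^ 2)).
    - apply L_ext; [easy|apply bdd_kernel; lra|].
      intros y Hy. rewrite Rmult_0_l, Rplus_0_r, pow1, Rinv_1. easy.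
    - rewrite L_kernel by lra. field. }
  assert (HK : 0 <= K).
  { assert (H0b : bdd (fun _ => 0 * 1)) by now apply bdd_scal.
    assert (H := L_mono (fun _ => 0 * 1) (fun _ => 1) H0b H1b ltac:(intros; lra)).
    rewrite (L_scal 0 (fun _ => 1) H1b), H1 in H. lra. }
  assert (HT : forall k s, 0 <= s ->
    L (fun y => kernel_taylor (S k) (s * y)) =
    L (fun y => kernel_taylor k (s * y)) +
      (-1) ^ S k * s ^ S k * (INR (S (S k)) * L (fun y => y ^ S k))).
  { intros j s Hs. cbn [kernel_taylor].
    assert (Hb : bdd (fun y => y ^ S j)) by apply bdd_pow, bdd_id.
    rewrite (L_ext _ (fun y => kernel_taylor j (s * y)
       + (-1) ^ S j * s ^ S j * INR (S (S j)) * y ^ S j)).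
    - rewrite (L_add (fun y => kernel_taylor j (s * y))
        (fun y => (-1) ^ S j * s ^ S j * INR (S (S j)) * y ^ S j)).
      + rewrite (L_scal _ (fun y => y ^ S j)) by easy. ring.
      + apply bdd_kernel_taylor.
      + now apply bdd_scal.
    - apply (bdd_kernel_taylor (S j)).
    - apply bdd_add; [apply bdd_kernel_taylor|now apply bdd_scal].
    - intros y Hy. rewrite Rpow_mult_distr. ring. }
  assert (Hmain : forall k s, 0 < s <= 1 ->
    Rabs (K / (1 + s) - L (fun y => kernel_taylor k (s * y)))
      <= (2 * INR k + 3) * K * s ^ S k).
  { intros j s Hs. rewrite <- L_kernel by lra.
    assert (Hrem : forall y, 0 < y < 1 ->
      Rabs (/ (1 + s * y) ^ 2 - kernel_taylor j (s * y)) <= (2 * INR j + 3) * s ^ S j * 1).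
    { intros y Hy. assert (0 <= s * y <= s) by nra.
      eapply Rle_trans; [apply kernel_taylor_rem; lra|].
      rewrite Rmult_1_r. apply Rmult_le_compat_l.
      - assert (Hj := pos_INR j). lra.
      - apply pow_incr; lra. }
    assert (Hbk := bdd_kernel s ltac:(lra)).
    assert (Hbt := bdd_kernel_taylor j s).
    set (c := (2 * INR j + 3) * s ^ S j) in *.
    assert (Hbc : bdd (fun _ => c * 1)) by now apply bdd_scal.
    assert (Hc1 := L_scal c (fun _ => 1) H1b). rewrite H1 in Hc1.
    assert (Hup : L (fun y => / (1 + s * y) ^ 2) <=
       L (fun y => kernel_taylor j (s * y) + c * 1)).
    { apply L_mono; [easy|now apply bdd_add|].
      intros y Hy. specialize (Hrem y Hy). apply Rabs_le_between in Hrem. lra. }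
    assert (Hlo : L (fun y => kernel_taylor j (s * y)) <=
       L (fun y => / (1 + s * y) ^ 2 + c * 1)).
    { apply L_mono; [easy|now apply bdd_add|].
      intros y Hy. specialize (Hrem y Hy). apply Rabs_le_between in Hrem. lra. }
    rewrite (L_add _ (fun _ => c * 1)) in Hup by easy.
    rewrite (L_add _ (fun _ => c * 1)) in Hlo by easy.
    replace ((2 * INR j + 3) * K * s ^ S j) with (c * K) by (unfold c; ring).
    apply Rabs_le_between. lra. }
  (* The induction carries the whole Taylor sum of degree [k] along with the moment, because the
     next comparison subtracts it. *)
  assert (Hind : forall k, (forall s, 0 < s <= 1 ->
      L (fun y => kernel_taylor k (s * y)) = K * inv_taylor k s)
      /\ INR (S k) * L (fun y => y ^ k) = K).
  { clear k. induction k as [|k [IH _]].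
    - split.
      + intros s Hs. simpl. rewrite H1. ring.
      + simpl. rewrite H1. ring.
    - assert (Hm : INR (S (S k)) * L (fun y => y ^ S k) = K).
      (* After division by [s ^ (k + 1)], the discrepancy between the two coefficients is bounded by
         a multiple of [s], for arbitrarily small [s]. *)
      { apply Rminus_diag_uniq_sym.
        apply (le_linear_eq_0 _ ((2 * INR (S k) + 3) * K + K)). intros s Hs.
        assert (Hsk : 0 < s ^ S k) by (apply pow_lt; lra).
        apply (Rmult_le_reg_r (s ^ S k)); [easy|].
        rewrite <- (Rabs_pos_eq (s ^ S k)) at 1 by lra.
        rewrite <- Rabs_mult.
        specialize (Hmain (S k) s Hs). rewrite HT, IH in Hmain by lra.
        assert (Hi := inv_taylor_eq (S k) s ltac:(lra)). cbn [inv_taylor] in Hi.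
        set (M := INR (S (S k)) * L (fun y => y ^ S k)) in *.
        assert (Habs : Rabs ((K - M) * s ^ S k) = Rabs ((-1) ^ S k * ((K - M) * s ^ S k)))
          by now rewrite (Rabs_mult ((-1) ^ S k)), Rabs_pow_neg1, Rmult_1_l.
        rewrite Habs.
        replace ((-1) ^ S k * ((K - M) * s ^ S k)) with
          ((K / (1 + s) - (K * inv_taylor k s + (-1) ^ S k * s ^ S k * M))
           - K * (/ (1 + s) - (inv_taylor k s + (-1) ^ S k * s ^ S k)))
          by (field; lra).
        rewrite Hi.
        eapply Rle_trans; [apply Rabs_triang|]. rewrite Rabs_Ropp.
        replace (K * ((-1) ^ S (S k) * s ^ S (S k) / (1 + s))) with
          ((-1) ^ S (S k) * (K * (s ^ S (S k) / (1 + s)))) by (unfold Rdiv; ring).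
        assert (Hs2 : 0 < s ^ S (S k)) by (apply pow_lt; lra).
        assert (Hd := div_le_l (s ^ S (S k)) (1 + s) ltac:(lra) ltac:(lra)).
        assert (0 < s ^ S (S k) / (1 + s)) by (apply Rdiv_lt_0_compat; lra).
        rewrite Rabs_sign_mul by nra.
        replace (((2 * INR (S k) + 3) * K + K) * s * s ^ S k) with
          ((2 * INR (S k) + 3) * K * s ^ S (S k) + K * s ^ S (S k)) by (simpl; ring).
        nra. }
      split; [|exact Hm].
      intros s Hs. rewrite HT, IH, Hm by lra. cbn [inv_taylor]. ring. }
  apply Hind.
Qed.

(** The beta integral, by induction from [(1 - y) ^ (j + 1) = (1 - y) ^ j - y (1 - y) ^ j]. *)
Lemma bernstein_moment i j :
  L (fun y => y ^ i * (1 - y) ^ j) =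
  K * (INR (fact i) * INR (fact j)) / INR (fact (i + j + 1)).
Proof.
  assert (Hf : forall n, INR (fact n) <> 0) by (intros; apply INR_fact_neq_0).
  revert i. induction j as [|j IH]; intros i.
  - rewrite (L_ext _ (fun y => y ^ i)).
    + rewrite <- (moment_eq i), Nat.add_0_r, Nat.add_1_r.
      rewrite fact_simpl, mult_INR. simpl fact at 2.
      assert (0 < INR (S i)) by (apply lt_0_INR; lia). specialize (Hf i).
      rewrite INR_1. field. lra.
    + apply bdd_bernstein.
    + apply bdd_pow, bdd_id.
    + intros y _. simpl. ring.
  - rewrite (L_ext _ (fun y => y ^ i * (1 - y) ^ j + (-1) * (y ^ S i * (1 - y) ^ j))).
    + rewrite (L_add (fun y => y ^ i * (1 - y) ^ j) (fun y => (-1) * (y ^ S i * (1 - y) ^ j))).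
      * rewrite (L_scal _ (fun y => y ^ S i * (1 - y) ^ j)) by apply bdd_bernstein.
        rewrite !IH. replace (i + S j + 1)%nat with (S (i + j + 1)) by lia.
        replace (S i + j + 1)%nat with (S (i + j + 1)) by lia.
        rewrite (fact_simpl i), (fact_simpl j), (fact_simpl (i + j + 1)), !mult_INR.
        assert (0 < INR (S (i + j + 1))) by (apply lt_0_INR; lia).
        assert (E : INR (S (i + j + 1)) = INR (S i) + INR (S j)).
        { rewrite <- plus_INR. f_equal. lia. }
        assert (Hfij := Hf (i + j + 1)%nat).
        apply (Rmult_eq_reg_r (INR (S (i + j + 1)) * INR (fact (i + j + 1)))); [|nra].
        field_simplify; [|lra|lra]. rewrite E. ring.
      * apply bdd_bernstein.
      * apply bdd_scal, bdd_bernstein.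
    + apply bdd_bernstein.
    + apply bdd_add; [apply bdd_bernstein|apply bdd_scal, bdd_bernstein].
    + intros y _. simpl. ring.
Qed.

(** The beta integral of [(y (1 - y)) ^ N] times [4 ^ N] has order [N ^ (- 1 / 2)]; squaring avoids
    the root. Consecutive values have ratio [(2 N + 2) / (2 N + 3)], whose square is at most
    [(N + 1) / (N + 2)]. *)
Lemma central_beta_bound N :
  (4 ^ N * (INR (fact N) * INR (fact N)) / INR (fact (N + N + 1))) ^ 2 <= / INR (S N).
Proof.
  induction N as [|N IH].
  - simpl. lra.
  - set (r := 4 ^ N * (INR (fact N) * INR (fact N)) / INR (fact (N + N + 1))) in *.
    assert (HN := pos_INR N).
    replace (4 ^ S N * (INR (fact (S N)) * INR (fact (S N))) / INR (fact (S N + S N + 1)))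
      with (r * ((2 * INR N + 2) / (2 * INR N + 3))).
    + rewrite Rpow_mult_distr.
      apply Rle_trans with (/ INR (S N) * ((2 * INR N + 2) / (2 * INR N + 3)) ^ 2).
      * apply Rmult_le_compat_r; [apply pow2_ge_0|exact IH].
      * rewrite !S_INR.
        apply (Rmult_le_reg_r ((INR N + 1) * (INR N + 1 + 1) * (2 * INR N + 3) ^ 2));
          [simpl; apply Rmult_lt_0_compat; nra|].
        field_simplify; nra.
    + unfold r. replace (S N + S N + 1)%nat with (S (S (N + N + 1))) by lia.
      rewrite !fact_simpl, !mult_INR.
      assert (Hf := INR_fact_neq_0 (N + N + 1)).
      rewrite (S_INR (S (N + N + 1))), (S_INR (N + N + 1)), !plus_INR, (S_INR N).
      simpl. field. repeat split; lra.
Qed.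

(** [y (1 - y)] has its maximum [/ 4] at [/ 2], so a mass [w] at that point would force the lower
    bound, while the moments of Lebesgue measure decay faster than [(/ 4) ^ N]. *)
Lemma moments_contradiction w :
  0 < w -> ~ (forall N, w * (/ 4) ^ N <= L (fun y => y ^ N * (1 - y) ^ N)).
Proof.
  intros Hw H.
  assert (Hb : forall N, (w * w) * INR (S N) <= K * K).
  { intros N. specialize (H N). rewrite bernstein_moment in H.
    assert (Hc := central_beta_bound N).
    set (r := 4 ^ N * (INR (fact N) * INR (fact N)) / INR (fact (N + N + 1))) in *.
    assert (H4 : 0 < 4 ^ N) by (apply pow_lt; lra).
    assert (Hwr : w <= K * r).
    { apply (Rmult_le_compat_l (4 ^ N)) in H; [|lra].
      replace (4 ^ N * (w * (/ 4) ^ N)) with w in H.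
      - eapply Rle_trans; [exact H|]. apply Req_le. unfold r, Rdiv. ring.
      - rewrite pow_inv. field. lra. }
    assert (HS : 0 < INR (S N)) by (apply lt_0_INR; lia).
    assert (Hr2 : r ^ 2 * INR (S N) <= 1).
    { apply (Rmult_le_reg_r (/ INR (S N))); [now apply Rinv_0_lt_compat|].
      rewrite Rmult_assoc, Rinv_r; lra. }
    assert (w * w <= K * K * r ^ 2) by (simpl; nra).
    assert (0 <= K * K) by nra. nra. }
  destruct (floor_multiple (K * K) (w * w)) as [m Hm]; [nra|nra|].
  specialize (Hb m). rewrite S_INR in Hb. nra.
Qed.

End Moments.

(** * Kernel sums over a geometric progression *)

Section Geometric.
Context (alpha : R) (alpha_gt1 : 1 < alpha).

Definition geo_sum (x : R) : R := Series (fun n => kern 0 (x / alpha ^ S n)).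

Lemma kern0_eq u : kern 0 u = u / (1 + u) ^ 2.
Proof. unfold kern. simpl. f_equal. ring. Qed.

Lemma kern0_inv u : 0 < u -> kern 0 (/ u) = kern 0 u.
Proof. intros Hu. rewrite !kern0_eq. field. lra. Qed.

Lemma kern0_bounds u : 0 < u -> 0 < kern 0 u <= u.
Proof.
  intros Hu. rewrite kern0_eq. split.
  - apply Rdiv_lt_0_compat; [easy|]. apply pow_lt; lra.
  - apply div_le_l; [lra|]. simpl; nra.
Qed.

Lemma kern0_Lipschitz u v : 0 < u -> 0 < v -> Rabs (kern 0 u - kern 0 v) <= Rabs (u - v).
Proof.
  intros Hu Hv. rewrite !kern0_eq.
  replace (u / (1 + u) ^ 2 - v / (1 + v) ^ 2) with
    ((u - v) * ((1 - u * v) / ((1 + u) ^ 2 * (1 + v) ^ 2))) by (field; lra).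
  rewrite Rabs_mult. rewrite <- (Rmult_1_r (Rabs (u - v))) at 2.
  apply Rmult_le_compat_l; [apply Rabs_pos|].
  assert (H1 : 1 + u * v <= (1 + u) ^ 2 * (1 + v) ^ 2).
  { assert (0 < u * v) by nra.
    assert (1 + u * v <= (1 + u) * (1 + v)) by nra.
    assert (1 <= (1 + u) * (1 + v)) by nra.
    rewrite <- Rpow_mult_distr. simpl. nra. }
  assert (H2 : 0 < u * v) by nra.
  rewrite Rabs_div by lra. rewrite (Rabs_pos_eq ((1 + u) ^ 2 * _)) by lra.
  apply (Rmult_le_reg_r ((1 + u) ^ 2 * (1 + v) ^ 2)); [lra|].
  unfold Rdiv. rewrite Rmult_assoc, Rinv_l, Rmult_1_l, Rmult_1_r by lra.
  apply Rabs_le_between. lra.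
Qed.

Lemma alpha_pow_pos n : 0 < alpha ^ n.
Proof. apply pow_lt. lra. Qed.

Lemma geo_arg_pos x n : 0 < x -> 0 < x / alpha ^ n.
Proof. intros H. apply Rdiv_lt_0_compat; [easy|apply alpha_pow_pos]. Qed.

Lemma ex_series_geo : ex_series (fun n => / alpha ^ n).
Proof.
  apply (ex_series_ext (fun n => (/ alpha) ^ n)).
  - intros n. apply pow_inv.
  - apply ex_series_geom. rewrite Rabs_pos_eq.
    + rewrite <- Rinv_1. apply Rinv_lt_contravar; lra.
    + left. apply Rinv_0_lt_compat. lra.
Qed.

Lemma ex_series_geo_S : ex_series (fun n => / alpha ^ S n).
Proof. apply (ex_series_incr_1 (fun n => / alpha ^ n)), ex_series_geo. Qed.

Lemma ex_geo_sum x : 0 < x -> ex_series (fun n => kern 0 (x / alpha ^ S n)).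
Proof.
  intros Hx.
  apply (ex_series_le (V := R_CompleteNormedModule) _ (fun n => x * / alpha ^ S n)).
  - intros n. destruct (kern0_bounds _ (geo_arg_pos x (S n) Hx)) as [H1 H2].
    change (Rabs (kern 0 (x / alpha ^ S n)) <= x * / alpha ^ S n).
    rewrite Rabs_pos_eq by lra. exact H2.
  - apply (ex_series_scal (V := R_NormedModule) x), ex_series_geo_S.
Qed.

Lemma geo_sum_bounds x : 0 < x -> 0 <= geo_sum x <= x * Series (fun n => / alpha ^ S n).
Proof.
  intros Hx. split.
  - apply Rle_trans with (psum (fun n => kern 0 (x / alpha ^ S n)) 0); [simpl; lra|].
    apply psum_le_Series; [now apply ex_geo_sum|].
    intros n. left. apply kern0_bounds, geo_arg_pos, Hx.
  - unfold geo_sum. rewrite <- Series_scal_l. apply Series_le.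
    + intros n. destruct (kern0_bounds _ (geo_arg_pos x (S n) Hx)) as [H1 H2].
      split; [lra|exact H2].
    + apply (ex_series_scal (V := R_NormedModule) x), ex_series_geo_S.
Qed.

Lemma geo_sum_alpha x : 0 < x -> geo_sum (alpha * x) = kern 0 x + geo_sum x.
Proof.
  intros Hx. unfold geo_sum. rewrite Series_incr_1.
  - f_equal.
    + f_equal. simpl. field. lra.
    + apply Series_ext. intros n. f_equal. simpl.
      assert (H := alpha_pow_pos n). field. lra.
  - apply ex_geo_sum. nra.
Qed.

Lemma geo_sum_Lipschitz x y : 0 < x -> 0 < y ->
  Rabs (geo_sum x - geo_sum y) <= Rabs (x - y) * Series (fun n => / alpha ^ S n).
Proof.
  intros Hx Hy. unfold geo_sum.
  rewrite <- Series_minus by now apply ex_geo_sum.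
  rewrite <- Series_scal_l.
  assert (Hle : forall n, Rabs (kern 0 (x / alpha ^ S n) - kern 0 (y / alpha ^ S n))
     <= Rabs (x - y) * / alpha ^ S n).
  { intros n. eapply Rle_trans; [apply kern0_Lipschitz; now apply geo_arg_pos|].
    replace (x / alpha ^ S n - y / alpha ^ S n) with ((x - y) * / alpha ^ S n)
      by (unfold Rdiv; ring).
    rewrite Rabs_mult, (Rabs_pos_eq (/ alpha ^ S n)); [lra|].
    left. apply Rinv_0_lt_compat, alpha_pow_pos. }
  assert (Hex : ex_series (fun n => Rabs (x - y) * / alpha ^ S n))
    by apply (ex_series_scal (V := R_NormedModule) (Rabs (x - y))), ex_series_geo_S.
  eapply Rle_trans; [apply Series_Rabs|apply Series_le; [|easy]].
  - apply (ex_series_le (V := R_CompleteNormedModule) _ (fun n => Rabs (x - y) * / alpha ^ S n)); [|easy].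
    intros n.
    change (Rabs (Rabs (kern 0 (x / alpha ^ S n) - kern 0 (y / alpha ^ S n)))
      <= Rabs (x - y) * / alpha ^ S n).
    rewrite Rabs_Rabsolu. apply Hle.
  - intros n. split; [apply Rabs_pos|apply Hle].
Qed.

(* The two-sided sum of [kern 0 (x / alpha ^ n)] over the integers [n], in view of [kern0_inv]. *)
Definition theta (x : R) : R := geo_sum x + kern 0 x + geo_sum (/ x).

Lemma theta_alpha x : 0 < x -> theta (alpha * x) = theta x.
Proof.
  intros Hx. unfold theta. rewrite geo_sum_alpha by easy.
  assert (Hax : 0 < / (alpha * x)) by (apply Rinv_0_lt_compat; nra).
  assert (H := geo_sum_alpha (/ (alpha * x)) Hax).
  replace (alpha * / (alpha * x)) with (/ x) in H by (field; lra).
  rewrite kern0_inv in H by nra. lra.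
Qed.

Lemma theta_alpha_pow n x : 0 < x -> theta (alpha ^ n * x) = theta x.
Proof.
  intros Hx. induction n as [|n IH]; simpl.
  - now rewrite Rmult_1_l.
  - rewrite Rmult_assoc, theta_alpha; [easy|].
    apply Rmult_lt_0_compat; [apply alpha_pow_pos|easy].
Qed.

(** By [kern0_inv] the terms missing from [geo_sum x] form a sum at [/ x], of size [O(1 / x)]. *)
Lemma theta_sub_geo_sum : tends_to (fun x => theta x - geo_sum x) 0.
Proof.
  intros eps Heps. set (s := Series (fun n => / alpha ^ S n)).
  assert (Hs : 0 <= s).
  { assert (H := geo_sum_bounds 1 Rlt_0_1). fold s in H. lra. }
  exists ((1 + s) / eps). split; [apply Rdiv_lt_0_compat; lra|].
  intros x Hx.
  assert (Hx0 : 0 < x).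
  { apply Rle_lt_trans with (2 := Hx). apply Rdiv_le_0_compat; lra. }
  assert (Hix : 0 < / x) by now apply Rinv_0_lt_compat.
  replace (theta x - geo_sum x - 0) with (kern 0 (/ x) + geo_sum (/ x))
    by (unfold theta; rewrite kern0_inv by easy; ring).
  assert (H1 := kern0_bounds (/ x) Hix). assert (H2 := geo_sum_bounds (/ x) Hix).
  fold s in H2. rewrite Rabs_pos_eq by lra.
  apply Rle_lt_trans with (/ x * (1 + s)); [lra|].
  apply (Rmult_lt_reg_l x); [easy|]. rewrite <- Rmult_assoc, Rinv_r, Rmult_1_l by lra.
  assert (E : (1 + s) / eps * eps = 1 + s) by (field; lra). nra.
Qed.

Lemma theta_continuous y : continuity_pt (fun y => theta (exp y)) y.
Proof.
  assert (Hg : forall y, continuity_pt (fun y => geo_sum (exp y)) y).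
  { clear y. intros y. apply continuity_pt_locally. intros eps.
    set (s := Series (fun n => / alpha ^ S n)).
    assert (Hs : 0 <= s).
    { assert (H := geo_sum_bounds 1 Rlt_0_1). fold s in H. lra. }
    assert (Hd : 0 < eps / (1 + s)) by (apply Rdiv_lt_0_compat; [apply cond_pos|lra]).
    assert (He : continuity_pt exp y) by (apply derivable_continuous_pt, derivable_pt_exp).
    rewrite continuity_pt_locally in He. specialize (He (mkposreal _ Hd)).
    revert He. apply filter_imp. intros z Hz. simpl in Hz.
    eapply Rle_lt_trans; [apply geo_sum_Lipschitz; apply exp_pos|]. fold s.
    assert (E : eps = eps / (1 + s) * (1 + s) :> R) by (field; lra).
    assert (0 <= Rabs (exp z - exp y)) by apply Rabs_pos. nra. }
  apply (continuity_pt_plus (fun y => geo_sum (exp y) + kern 0 (exp y)) (fun y => geo_sum (/ exp y)));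
    [apply (continuity_pt_plus (fun y => geo_sum (exp y)) (fun y => kern 0 (exp y)))|].
  - apply Hg.
  - apply (continuity_pt_ext (fun y => exp y / (1 + exp y) ^ 2)).
    { intros t. now rewrite kern0_eq. }
    assert (H := exp_pos y).
    apply derivable_continuous_pt, ex_derive_Reals_0. auto_derive. apply Rgt_not_eq. nra.
  - apply (continuity_pt_ext (fun y => geo_sum (exp (- y)))).
    { intros t. now rewrite exp_Ropp. }
    apply (continuity_pt_comp Ropp (fun y => geo_sum (exp y))).
    + apply continuity_pt_opp, continuity_pt_id.
    + apply Hg.
Qed.

Definition weight (a : R) : R := a / (1 + a) ^ 2.

(** The series of these is the integral of [q] for the measure with mass [weight a] at
    [1 / (1 + a)], where [a] runs over the integral powers of [alpha]: the exponents [n + 1] and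
    [- n] meet every integer once. It comes from [kern 0 ((1 + s) / a) = (1 + s) weight a / (1 + s
    y) ^ 2] with [y = 1 / (1 + a)]. *)
Definition sample (q : R -> R) (n : nat) : R :=
  weight (alpha ^ S n) * q (/ (1 + alpha ^ S n)) + weight (/ alpha ^ n) * q (/ (1 + / alpha ^ n)).

Lemma weight_pos a : 0 < a -> 0 < weight a.
Proof. intros H. apply Rdiv_lt_0_compat; [easy|apply pow_lt; lra]. Qed.

Lemma weight_inv a : 0 < a -> weight (/ a) = weight a.
Proof. intros H. unfold weight. field. lra. Qed.

Lemma weight_le a : 0 < a -> weight a <= a.
Proof. intros H. apply div_le_l; [lra|simpl; nra]. Qed.

Lemma point_bd a : 0 < a -> 0 < / (1 + a) < 1.
Proof.
  intros H. split; [apply Rinv_0_lt_compat; lra|].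
  rewrite <- Rinv_1. apply Rinv_lt_contravar; lra.
Qed.

Lemma inv_alpha_pow_pos n : 0 < / alpha ^ n.
Proof. apply Rinv_0_lt_compat, alpha_pow_pos. Qed.

Lemma ex_sample q : bdd q -> ex_series (sample q).
Proof.
  intros [B HB].
  apply (ex_series_le (V := R_CompleteNormedModule) _
    (fun n => B * (/ alpha ^ S n + / alpha ^ n))).
  - intros n. change (Rabs (sample q n) <= B * (/ alpha ^ S n + / alpha ^ n)). unfold sample.
    assert (Ha := alpha_pow_pos (S n)). assert (Hb := inv_alpha_pow_pos n).
    assert (H1 := HB _ (point_bd _ Ha)). assert (H2 := HB _ (point_bd _ Hb)).
    assert (W1 := weight_pos _ Ha). assert (W2 := weight_pos _ Hb).
    assert (V1 := weight_le _ (inv_alpha_pow_pos (S n))). rewrite weight_inv in V1 by easy.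
    assert (V2 := weight_le _ Hb).
    eapply Rle_trans; [apply Rabs_triang|].
    rewrite !Rabs_mult, (Rabs_pos_eq (weight _)), (Rabs_pos_eq (weight (/ _))) by lra.
    assert (0 <= Rabs (q (/ (1 + alpha ^ S n)))) by apply Rabs_pos.
    assert (0 <= Rabs (q (/ (1 + / alpha ^ n)))) by apply Rabs_pos.
    assert (0 <= B) by lra.
    rewrite Rmult_plus_distr_l, (Rmult_comm B), (Rmult_comm B).
    apply Rplus_le_compat; apply Rmult_le_compat; lra.
  - apply (ex_series_scal (V := R_NormedModule) B),
      (ex_series_plus (V := R_NormedModule)); [apply ex_series_geo_S|apply ex_series_geo].
Qed.

Lemma theta_nonconstant K : ~ (forall x, 0 < x -> theta x = K).
Proof.
  intros Hth.
  apply (moments_contradiction (fun q => Series (sample q)) K) with (w := / 4).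
  - intros p q Hp Hq. rewrite <- Series_plus by now apply ex_sample.
    apply Series_ext. intros n. unfold sample. ring.
  - intros c q Hq. rewrite <- Series_scal_l.
    apply Series_ext. intros n. unfold sample. ring.
  - intros p q Hp Hq H.
    apply Rminus_le. rewrite <- Series_minus by now apply ex_sample.
    apply Series_le_bound.
    { apply (ex_series_minus (V := R_NormedModule)); now apply ex_sample. }
    intros k. induction k as [|k IH]; cbn [psum]; [lra|].
    assert (sample p k <= sample q k); [|lra].
    unfold sample.
    assert (Ha := alpha_pow_pos (S k)). assert (Hb := inv_alpha_pow_pos k).
    assert (W1 := weight_pos _ Ha). assert (W2 := weight_pos _ Hb).
    assert (H1 := H _ (point_bd _ Ha)). assert (H2 := H _ (point_bd _ Hb)).
    apply Rplus_le_compat; apply Rmult_le_compat_l; lra.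
  - intros s Hs.
    assert (Hx : 0 < 1 + s) by lra. assert (Hix := Rinv_0_lt_compat _ Hx).
    rewrite <- (Hth (1 + s) Hx). unfold theta, geo_sum.
    replace (Series (fun n => kern 0 ((1 + s) / alpha ^ S n)) + kern 0 (1 + s) +
      Series (fun n => kern 0 (/ (1 + s) / alpha ^ S n))) with
      (Series (fun n => kern 0 ((1 + s) / alpha ^ S n) + kern 0 (/ (1 + s) / alpha ^ n))).
    + unfold Rdiv. rewrite <- Series_scal_r. apply Series_ext. intros n.
      unfold sample, weight. rewrite !kern0_eq.
      assert (Ha := alpha_pow_pos (S n)). assert (Hb := alpha_pow_pos n).
      set (a := alpha ^ S n) in *. set (b := alpha ^ n) in *.
      clearbody a b. field. repeat split; nra.
    (* The middle term of [theta] becomes the term of exponent [0] of the second sum, as [kern 0] is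
       invariant under inversion. *)
    + assert (Hex : ex_series (fun n => kern 0 (/ (1 + s) / alpha ^ n))).
      { apply ex_series_incr_1. now apply ex_geo_sum. }
      rewrite Series_plus; [|now apply ex_geo_sum|easy].
      rewrite (Series_incr_1 (fun n => kern 0 (/ (1 + s) / alpha ^ n))) by easy.
      rewrite pow_O, Rdiv_1_r, kern0_inv by easy. ring.
  - lra.
  - intros N. assert (Hb := bdd_bernstein N N).
    set (q := fun y => y ^ N * (1 - y) ^ N) in *.
    assert (Hq : forall y, 0 < y < 1 -> 0 <= q y).
    { intros y Hy. apply Rmult_le_pos; apply pow_le; lra. }
    assert (Hpos : forall n, 0 <= sample q n).
    { intros n. unfold sample.
      assert (Ha := alpha_pow_pos (S n)). assert (Hb' := inv_alpha_pow_pos n).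
      assert (W1 := weight_pos _ Ha). assert (W2 := weight_pos _ Hb').
      assert (H1 := Hq _ (point_bd _ Ha)). assert (H2 := Hq _ (point_bd _ Hb')).
      assert (0 <= weight (alpha ^ S n) * q (/ (1 + alpha ^ S n))) by (apply Rmult_le_pos; lra).
      assert (0 <= weight (/ alpha ^ n) * q (/ (1 + / alpha ^ n))) by (apply Rmult_le_pos; lra).
      lra. }
    (* One term is enough: it contains the exponent [0], an atom of mass [/ 4] at [/ 2]. *)
    apply Rle_trans with (psum (sample q) 1); [|now apply psum_le_Series; [apply ex_sample|]].
    cbn [psum]. unfold sample at 1.
    assert (Ha := alpha_pow_pos 1). assert (W1 := weight_pos _ Ha).
    assert (H1 := Hq _ (point_bd _ Ha)).
    assert (0 <= weight (alpha ^ 1) * q (/ (1 + alpha ^ 1))) by (apply Rmult_le_pos; lra).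
    replace (weight (/ alpha ^ 0) * q (/ (1 + / alpha ^ 0))) with (/ 4 * (/ 4) ^ N); [lra|].
    unfold q. rewrite <- Rpow_mult_distr, pow_O. unfold weight.
    rewrite Rinv_1. f_equal; [simpl; lra|]. f_equal. lra.
Qed.

Definition is_period (c : R) : Prop :=
  0 < c /\ tends_to (fun x => geo_sum (c * x) - geo_sum x) 0.

(** A function invariant under [alpha] repeats its values arbitrarily far out, so a difference
    [theta (c x) - theta x] that tends to [0] vanishes identically. *)
Lemma is_period_theta c : is_period c <-> 0 < c /\ forall x, 0 < x -> theta (c * x) = theta x.
Proof.
  split; intros [Hc H]; (split; [easy|]).
  - assert (Hlim : tends_to (fun x => theta (c * x) - theta x) 0).
    { apply (tends_to_ext (fun x => (theta (c * x) - geo_sum (c * x) - (theta x - geo_sum x))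
        + (geo_sum (c * x) - geo_sum x))); [intros; ring|].
      replace 0 with (0 - 0 + 0) by ring.
      apply tends_to_plus; [|easy]. apply tends_to_minus; [|apply theta_sub_geo_sum].
      apply (tends_to_dilate c (fun x => theta x - geo_sum x) 0 Hc theta_sub_geo_sum). }
    intros x Hx. apply Rminus_diag_uniq. apply NNPP. intros Hne.
    destruct (Hlim _ (Rabs_pos_lt _ Hne)) as [X [HX HlimX]].
    destruct (Pow_x_infinity alpha) with (b := X / x) as [n Hn].
    { rewrite Rabs_pos_eq; lra. }
    specialize (Hn (S n) ltac:(lia)).
    assert (Hp := alpha_pow_pos (S n)). rewrite Rabs_pos_eq in Hn by lra.
    assert (Hp1 : alpha ^ S (S n) * x > X).
    { assert (E : X / x * x = X) by (field; lra).
      rewrite <- tech_pow_Rmult, Rmult_assoc.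
      assert (0 < alpha ^ S n * x) by (apply Rmult_lt_0_compat; lra).
      assert (X <= alpha ^ S n * x).
      { rewrite <- E. apply Rmult_le_compat_r; lra. }
      nra. }
    specialize (HlimX _ Hp1).
    replace (c * (alpha ^ S (S n) * x)) with (alpha ^ S (S n) * (c * x)) in HlimX by ring.
    rewrite !theta_alpha_pow in HlimX by nra. rewrite Rminus_0_r in HlimX. lra.
  - apply (tends_to_ext (fun x => (theta x - geo_sum x) - (theta (c * x) - geo_sum (c * x)))).
    { intros x Hx. rewrite H by easy. ring. }
    replace 0 with (0 - 0) by ring. apply tends_to_minus; [apply theta_sub_geo_sum|].
    apply (tends_to_dilate c (fun x => theta x - geo_sum x) 0 Hc theta_sub_geo_sum).
Qed.

Lemma is_period_mult c d : is_period c -> is_period d -> is_period (c * d).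
Proof.
  rewrite !is_period_theta. intros [Hc H] [Hd H']. split; [nra|].
  intros x Hx. rewrite Rmult_assoc, H by nra. auto.
Qed.

Lemma is_period_inv c : is_period c -> is_period (/ c).
Proof.
  rewrite !is_period_theta. intros [Hc H].
  assert (Hic := Rinv_0_lt_compat c Hc). split; [easy|].
  intros x Hx. rewrite <- (H (/ c * x)) by nra.
  f_equal. field. lra.
Qed.

(** The logarithms of the periods form a group. If it had arbitrarily small positive elements, their
    multiples would be dense and continuity would make [theta] constant. The generator [a] may be
    smaller than [alpha]. *)
Lemma periods_cyclic :
  exists a, 1 < a /\ forall c, is_period c <-> exists m : Z, c = exp (IZR m * ln a).
Proof.
  assert (Halpha : is_period alpha).
  { apply is_period_theta. split; [lra|]. apply theta_alpha. }
  assert (Hln : 0 < ln alpha) by (rewrite <- ln_1; apply ln_increasing; lra).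
  assert (Hsub : forall x y, is_period (exp x) -> is_period (exp y) -> is_period (exp (x - y))).
  { intros x y Hx Hy. unfold Rminus. rewrite exp_plus, exp_Ropp.
    now apply is_period_mult, is_period_inv. }
  assert (Hone : is_period (exp 0)).
  { apply is_period_theta. rewrite exp_0. split; [lra|]. intros; now rewrite Rmult_1_l. }
  assert (Hgap : exists delta, 0 < delta /\ forall x, is_period (exp x) -> ~ 0 < x < delta).
  { apply NNPP. intros Hno. apply (theta_nonconstant (theta 1)).
    intros x Hx. rewrite <- (exp_ln x Hx). set (y := ln x).
    apply NNPP. intros Hne. assert (Hd : theta (exp y) - theta 1 <> 0) by lra.
    assert (Hcont := theta_continuous y). rewrite continuity_pt_locally in Hcont.
    destruct (Hcont (mkposreal _ (Rabs_pos_lt _ Hd))) as [delta Hdelta]. simpl in Hdelta.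
    apply Hno. exists delta. split; [apply cond_pos|]. intros e He Hed.
    assert (Hz : forall k : Z, is_period (exp (IZR k * e))).
    { assert (Hnat : forall n : nat, is_period (exp (INR n * e))).
      { induction n as [|n IH]; [simpl; now rewrite Rmult_0_l|].
        rewrite S_INR, Rmult_plus_distr_r, Rmult_1_l, exp_plus. now apply is_period_mult. }
      intros k. destruct (Z_lt_le_dec k 0) as [Hk|Hk].
      - replace (IZR k * e) with (0 - INR (Z.to_nat (- k)) * e); [auto|].
        rewrite INR_IZR_INZ, Z2Nat.id, opp_IZR by lia. ring.
      - rewrite <- (Z2Nat.id k Hk), <- INR_IZR_INZ. apply Hnat. }
    destruct (base_Int_part (y / e)) as [Hi1 Hi2].
    set (k := Int_part (y / e)) in *.
    assert (Hye : y = y / e * e) by (field; lra).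
    assert (Hball : Rabs (IZR k * e - y) < delta).
    { apply Rabs_def1; nra. }
    specialize (Hdelta _ Hball).
    specialize (Hz k). apply is_period_theta in Hz. destruct Hz as [_ Hz].
    specialize (Hz 1 Rlt_0_1). rewrite Rmult_1_r in Hz. rewrite Hz in Hdelta.
    rewrite Rabs_minus_sym in Hdelta. lra. }
  destruct Hgap as [delta [Hd Hgap]].
  destruct (discrete_subgroup_cyclic (fun x => is_period (exp x)) delta (ln alpha))
    as [g [Hg [Hpg Hc]]]; auto.
  { rewrite exp_ln; [easy|lra]. }
  exists (exp g). split.
  { rewrite <- exp_0. now apply exp_increasing. }
  intros c. rewrite ln_exp. split.
  - intros H. destruct (Hc (ln c)) as [m Hm].
    { rewrite exp_ln; [easy|apply H]. }
    exists m. rewrite <- Hm, exp_ln; [easy|apply H].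
  - intros [m ->].
    assert (Hnat : forall n : nat, is_period (exp (INR n * g))).
    { induction n as [|n IH]; [simpl; now rewrite Rmult_0_l|].
      rewrite S_INR, Rmult_plus_distr_r, Rmult_1_l, exp_plus. now apply is_period_mult. }
    destruct (Z_lt_le_dec m 0) as [Hk|Hk].
    + replace (IZR m * g) with (0 - INR (Z.to_nat (- m)) * g); [auto|].
      rewrite INR_IZR_INZ, Z2Nat.id, opp_IZR by lia. ring.
    + rewrite <- (Z2Nat.id m Hk), <- INR_IZR_INZ. apply Hnat.
Qed.

End Geometric.

(** * Coding the integers by two real parameters *)

Lemma least_index (P : nat -> Prop) :
  (exists n, P n) -> exists n, P n /\ forall m, (m < n)%nat -> ~ P m.
Proof.
  intros [n Hn]. induction n as [n IH] using (well_founded_induction lt_wf).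
  destruct (classic (exists m, (m < n)%nat /\ P m)) as [[m [Hm HPm]]|Hno].
  - now apply (IH m).
  - exists n. split; [easy|]. intros m Hm HPm. apply Hno. now exists m.
Qed.

Lemma nested_intervals (a b : nat -> R) :
  (forall k, a k < a (S k)) -> (forall k, b (S k) < b k) -> (forall k, a k < b k) ->
  exists c, forall k, a k < c < b k.
Proof.
  intros Ha Hb Hab.
  assert (Hainc : forall j d, a j <= a (j + d)%nat).
  { intros j d. induction d as [|d IH]; [rewrite Nat.add_0_r; lra|].
    rewrite Nat.add_succ_r. specialize (Ha (j + d)%nat). lra. }
  assert (Hbdec : forall j d, b (j + d)%nat <= b j).
  { intros j d. induction d as [|d IH]; [rewrite Nat.add_0_r; lra|].
    rewrite Nat.add_succ_r. specialize (Hb (j + d)%nat). lra. }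
  assert (Hall : forall j k, a j <= b k).
  { intros j k. specialize (Hainc j k). specialize (Hbdec k j).
    specialize (Hab (j + k)%nat). rewrite (Nat.add_comm k j) in Hbdec. lra. }
  destruct (completeness (fun x => exists k, x = a k)) as [c [Hc1 Hc2]].
  - exists (b O). intros x [k ->]. apply Hall.
  - now exists (a O), O.
  - exists c. intros k. split.
    + apply Rlt_le_trans with (a (S k)); [easy|]. apply Hc1. now exists (S k).
    + apply Rle_lt_trans with (b (S k)); [|easy]. apply Hc2. intros x [j ->]. apply Hall.
Qed.

Section Coding.
Context (w : nat -> R) (A B : R).
Hypothesis w_bounds : forall n, A <= w n < B.
Hypothesis w_dense : forall l r, A <= l -> l < r -> r <= B -> exists n, l < w n < r.

(** The successive best approximations of [c] from below. They can be made as sparse as desired by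
    the choice of [c], which thus codes a set of indices. *)
Definition low_record (c : R) (j : nat) : Prop :=
  w j < c /\ forall i, (i < j)%nat -> w i < c -> w i < w j.

(** [p] and [q] are the neighbours of [c] among [w 0], ..., [w n], and [s] is the inverse of the
    relative position of [c] between them. *)
Definition gap_ratio (c : R) (n : nat) (s : R) : Prop :=
  exists p q, (exists i, (i <= n)%nat /\ w i = p) /\ (exists i, (i <= n)%nat /\ w i = q) /\
    p < c /\ c < q /\ (forall i, (i <= n)%nat -> w i <= p \/ q <= w i) /\ s * (c - p) = q - p.

(** An open interval and not a single value, so that the parameter can still be refined; its length
    tends to [0]. The shift by [2] keeps the point with that ratio strictly below the right end of
    the gap. *)
Definition near_index (k : nat) (s : R) : Prop :=
  INR k + 2 < s < INR k + 2 + / (INR k + 1).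

Lemma gap_ratio_unique c n s s' : gap_ratio c n s -> gap_ratio c n s' -> s = s'.
Proof.
  intros (p & q & [i [Hi Hp]] & [i' [Hi' Hq]] & Hpc & Hcq & Hgap & Hs)
         (p' & q' & [j [Hj Hp']] & [j' [Hj' Hq']] & Hpc' & Hcq' & Hgap' & Hs').
  assert (p = p').
  { apply Rle_antisym.
    - destruct (Hgap' i Hi); lra.
    - destruct (Hgap j Hj); lra. }
  assert (q = q').
  { apply Rle_antisym.
    - destruct (Hgap j' Hj'); lra.
    - destruct (Hgap' i' Hi'); lra. }
  clear Hp Hq Hp' Hq'. subst p' q'. apply (Rmult_eq_reg_r (c - p)); lra.
Qed.

Lemma gap_above N u r : u < r ->
  exists q, u < q <= r /\ forall j, (j <= N)%nat -> w j <= u \/ q <= w j.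
Proof.
  intros Hur. induction N as [|N [q [Hq HN]]].
  - destruct (Rle_lt_dec (w O) u) as [H|H].
    + exists r. split; [lra|]. intros j Hj. left. now replace j with O by lia.
    + exists (Rmin r (w O)). split.
      * split; [now apply Rmin_glb_lt|apply Rmin_l].
      * intros j Hj. right. replace j with O by lia. apply Rmin_r.
  - destruct (Rle_lt_dec (w (S N)) u) as [H|H].
    + exists q. split; [easy|]. intros j Hj.
      destruct (Nat.eq_dec j (S N)) as [->|]; [now left|apply HN; lia].
    + exists (Rmin q (w (S N))). split.
      * split; [now apply Rmin_glb_lt|]. eapply Rle_trans; [apply Rmin_l|lra].
      * intros j Hj. destruct (Nat.eq_dec j (S N)) as [->|].
        -- right. apply Rmin_r.
        -- destruct (HN j ltac:(lia)) as [H'|H']; [now left|right].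
           eapply Rle_trans; [apply Rmin_l|easy].
Qed.

Lemma best_index (P : nat -> Prop) (f : nat -> R) N :
  (exists i, (i <= N)%nat /\ P i) ->
  exists i, (i <= N)%nat /\ P i /\ forall j, (j <= N)%nat -> P j -> f j <= f i.
Proof.
  intros [i0 [Hi0 HP0]].
  assert (H : forall M, (forall i, (i <= M)%nat -> ~ P i) \/
    exists i, (i <= M)%nat /\ P i /\ forall j, (j <= M)%nat -> P j -> f j <= f i).
  { induction M as [|M [IH|[i [Hi [HPi Hmax]]]]].
    - destruct (classic (P O)) as [H|H].
      + right. exists O. repeat split; auto. intros j Hj _. replace j with O by lia. lra.
      + left. intros i Hi. now replace i with O by lia.
    - destruct (classic (P (S M))) as [H|H].
      + right. exists (S M). repeat split; auto. intros j Hj HPj.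
        destruct (Nat.eq_dec j (S M)) as [->|]; [lra|]. exfalso. apply (IH j); [lia|easy].
      + left. intros i Hi. destruct (Nat.eq_dec i (S M)) as [->|]; [easy|apply IH; lia].
    - right. destruct (classic (P (S M) /\ f i < f (S M))) as [[H Hlt]|H].
      + exists (S M). repeat split; auto. intros j Hj HPj.
        destruct (Nat.eq_dec j (S M)) as [->|]; [lra|].
        specialize (Hmax j ltac:(lia) HPj). lra.
      + exists i. repeat split; auto. intros j Hj HPj.
        destruct (Nat.eq_dec j (S M)) as [->|]; [|apply Hmax; auto; lia].
        apply Rnot_lt_le. intros Hlt. now apply H. }
  destruct (H N) as [Hno|Hyes]; [|easy].
  exfalso. now apply (Hno i0).
Qed.

(* The parameter [c1] is sought in [(w idx, hi1)] and [c2] in [(lo2, hi2)]. *)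
Record stage := Stage { idx : nat; hi1 : R; lo2 : R; hi2 : R }.

Definition stage_ok (x : stage) : Prop :=
  w (idx x) < hi1 x /\ hi1 x <= B /\ A <= lo2 x /\ lo2 x < hi2 x /\ hi2 x <= B.

(** The condition on the indices below [idx y] ensures that, for each [c1] between [w (idx y)] and
    [hi1 y], no low record lies strictly between [idx x] and [idx y], and that [idx y] is one. *)
Definition refines (k : nat) (x y : stage) : Prop :=
  (idx x < idx y)%nat /\ w (idx x) < w (idx y) /\ hi1 y < hi1 x /\
  (forall j, (j < idx y)%nat -> w j <= w (idx x) \/ hi1 y <= w j) /\
  lo2 x < lo2 y /\ hi2 y < hi2 x /\
  (forall c, lo2 y < c < hi2 y -> exists s, near_index k s /\ gap_ratio c (idx y) s).

Lemma refine_stage k x : stage_ok x -> exists y, stage_ok y /\ refines k x y.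
Proof.
  destruct x as [n r1 l2 r2]. unfold stage_ok, refines. cbn.
  intros (H1 & H2 & H3 & H4 & H5).
  (* Terms of the sequence on both sides of [mid] inside [(l2, r2)] force the neighbours [p] and [q]
     chosen below into that interval. *)
  set (mid := (l2 + r2) / 2).
  destruct (w_dense l2 mid) as [i1 Hi1]; [lra|unfold mid; lra|unfold mid; lra|].
  destruct (w_dense mid r2) as [i2 Hi2]; [unfold mid; lra|unfold mid; lra|lra|].
  set (N := (n + i1 + i2)%nat).
  (* No term of index at most [N] lies strictly between [w n] and [q'], so the next record comes
     after all the indices in use. *)
  destruct (gap_above N (w n) r1 H1) as [q' [Hq' Hgap]].
  destruct (least_index (fun j => w n < w j < q')) as [n' [Hn' Hleast]].
  { apply w_dense; [apply w_bounds|lra|lra]. }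
  assert (HN : (N < n')%nat).
  { apply Nat.nle_gt. intros Hle. destruct (Hgap n' Hle); lra. }
  destruct (best_index (fun j => w j <= mid) w n') as [ip [Hip [Hpm Hpmax]]].
  { exists i1. split; [lia|lra]. }
  destruct (best_index (fun j => mid < w j) (fun j => - w j) n') as [iq [Hiq [Hqm Hqmin]]].
  { exists i2. split; [lia|lra]. }
  assert (Hp1 : w i1 <= w ip) by (apply Hpmax; [lia|lra]).
  assert (Hq1 : - w i2 <= - w iq) by (apply Hqmin; [lia|lra]).
  set (p := w ip) in *. set (q := w iq) in *.
  assert (Hk := pos_INR k).
  set (tau := / (INR k + 1)).
  assert (Htau : 0 < tau) by (apply Rinv_0_lt_compat; lra).
  (* The points with ratio [k + 2 + tau] and [k + 2]: the ratio decreases as the point moves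
     right. *)
  set (lo := p + (q - p) / (INR k + 2 + tau)). set (hi := p + (q - p) / (INR k + 2)).
  assert (Hlo : (lo - p) * (INR k + 2 + tau) = q - p) by (unfold lo; field; lra).
  assert (Hhi : (hi - p) * (INR k + 2) = q - p) by (unfold hi; field; lra).
  assert (Hlop : p < lo).
  { assert (0 < (q - p) / (INR k + 2 + tau)) by (apply Rdiv_lt_0_compat; lra). unfold lo. lra. }
  assert (Hhip : p < hi).
  { assert (0 < (q - p) / (INR k + 2)) by (apply Rdiv_lt_0_compat; lra). unfold hi. lra. }
  assert (Hhq : hi < q) by nra.
  assert (Hlh : lo < hi) by nra.
  exists (Stage n' ((w n' + q') / 2) lo hi). cbn.
  repeat split; try lra; try (unfold N in HN; lia).
  - intros j Hj. specialize (Hleast j Hj).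
    destruct (Rle_lt_dec (w j) (w n)) as [H|H]; [now left|right]. lra.
  - intros c Hc. exists ((q - p) / (c - p)).
    assert (Hs : (q - p) / (c - p) * (c - p) = q - p) by (field; lra).
    set (s := (q - p) / (c - p)) in *. split.
    + unfold near_index. fold tau. split; apply (Rmult_lt_reg_r (c - p)); nra.
    + exists p, q. repeat split; auto.
      * now exists ip.
      * now exists iq.
      * lra.
      * lra.
      * intros i Hi. destruct (Rle_lt_dec (w i) mid) as [H|H].
        -- left. now apply Hpmax.
        -- right. specialize (Hqmin i Hi H). lra.
Qed.

(** The low records of [c1] are exactly the indices of the stages, and at each stage after the
    initial one [c2] has the prescribed ratio; the stage [S k] carries the number [k]. *)
Lemma coding :
  exists c1 c2,
    (forall j s, low_record c1 j -> gap_ratio c2 j s -> exists k, near_index k s) /\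
    (forall k, exists j s, low_record c1 j /\ gap_ratio c2 j s /\ near_index k s).
Proof.
  assert (Hx0 : stage_ok (Stage O B A B)).
  { assert (H := w_bounds O). unfold stage_ok; cbn. lra. }
  set (next := fun k (x : {x | stage_ok x}) =>
    let (y, Hy) := constructive_indefinite_description _ (refine_stage k (proj1_sig x) (proj2_sig x))
    in exist stage_ok y (proj1 Hy)).
  assert (Hnext : forall k x, refines k (proj1_sig x) (proj1_sig (next k x))).
  { intros k x. unfold next.
    destruct (constructive_indefinite_description _ _) as [y Hy]. apply Hy. }
  set (st := fix st k := match k with O => exist stage_ok _ Hx0 | S k => next k (st k) end).
  set (x := fun k => proj1_sig (st k)).
  assert (Hok : forall k, stage_ok (x k)) by (intros k; apply (proj2_sig (st k))).
  assert (Hst : forall k, refines k (x k) (x (S k))) by (intros k; apply (Hnext k (st k))).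
  clearbody next.
  assert (Hidx0 : idx (x O) = O) by reflexivity.
  clearbody x. clear st Hnext next Hx0.
  destruct (nested_intervals (fun k => w (idx (x k))) (fun k => hi1 (x k))) as [c1 Hc1];
    [apply Hst|apply Hst|apply Hok|].
  destruct (nested_intervals (fun k => lo2 (x k)) (fun k => hi2 (x k))) as [c2 Hc2];
    [apply Hst|apply Hst|apply Hok|].
  assert (Hrec : forall k, low_record c1 (idx (x k))).
  { intros k. split; [apply Hc1|]. intros i Hi Hw. destruct k as [|k]; [lia|].
    destruct (Hst k) as (_ & Hinc & _ & Hskip & _).
    destruct (Hskip i Hi) as [H|H]; [lra|]. specialize (Hc1 (S k)). lra. }
  assert (Hcov : forall j k, (j <= idx (x k))%nat -> low_record c1 j -> exists k', j = idx (x k')).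
  { intros j k. induction k as [|k IH]; intros Hj Hr.
    - exists O. lia.
    - destruct (Nat.le_gt_cases j (idx (x k))) as [H|H]; [now apply IH|].
      destruct (Nat.eq_dec j (idx (x (S k)))) as [E|E]; [now exists (S k)|]. exfalso.
      destruct (Hst k) as (_ & _ & _ & Hskip & _). destruct Hr as [Hr1 Hr2].
      specialize (Hr2 _ H (proj1 (Hc1 k))).
      destruct (Hskip j ltac:(lia)) as [H'|H']; [lra|]. specialize (Hc1 (S k)). lra. }
  assert (Hidx : forall k, (k <= idx (x k))%nat).
  { induction k as [|k IH]; [lia|]. destruct (Hst k) as [H _]. lia. }
  assert (Hgap : forall k, exists s, near_index k s /\ gap_ratio c2 (idx (x (S k))) s).
  { intros k. destruct (Hst k) as (_ & _ & _ & _ & _ & _ & H). apply H, Hc2. }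
  exists c1, c2. split.
  - intros j s Hr Hs. destruct (Hcov j j (Hidx j) Hr) as [[|k] ->].
    (* At index [0] a single term would have to lie on both sides of [c2], so the initial stage
       codes nothing. *)
    + exfalso. rewrite Hidx0 in Hs.
      destruct Hs as (p & q & [i [Hi Hp]] & [i' [Hi' Hq]] & Hpc & Hcq & _).
      replace i with O in Hp by lia. replace i' with O in Hq by lia. lra.
    + exists k. destruct (Hgap k) as [s' [Hn Hs']].
      now rewrite (gap_ratio_unique _ _ _ _ Hs Hs').
  - intros k. destruct (Hgap k) as [s [Hn Hs]]. now exists (idx (x (S k))), s.
Qed.

End Coding.

(** Far elements of [P] are integers up to small errors, so their differences are nearly integers
    and every integer arises this way; the quantifiers on [eps] and [X] remove the errors. *)
Lemma integer_difference_set (P : R -> Prop) :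
  (forall s, P s -> exists k, near_index k s) ->
  (forall k, exists s, P s /\ near_index k s) ->
  forall m, is_integer m <->
    forall eps, 0 < eps -> exists X, forall s, P s -> X < s ->
      exists s', P s' /\ Rabs (s' - s - m) < eps.
Proof.
  intros Hnear Hex m.
  assert (Hsmall : forall eps, 0 < eps -> exists K, forall k, (K <= k)%nat -> / (INR k + 1) < eps).
  { intros eps Heps. destruct (floor_multiple (/ eps) 1) as [K HK];
      [left; now apply Rinv_0_lt_compat|lra|].
    exists K. intros k Hk. apply le_INR in Hk.
    rewrite <- (Rinv_inv eps). apply Rinv_lt_contravar.
    - apply Rmult_lt_0_compat; [now apply Rinv_0_lt_compat|].
      assert (H := pos_INR k). lra.
    - lra. }
  assert (Hle1 : forall k, / (INR k + 1) <= 1).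
  { intros k. assert (H := pos_INR k). rewrite <- Rinv_1 at 2. apply Rinv_le_contravar; lra. }
  split.
  - intros [z ->] eps Heps. destruct (Hsmall eps Heps) as [K HK].
    exists (INR K + Rabs (IZR z) + 4). intros s Hs HX.
    destruct (Hnear s Hs) as [k Hk]. unfold near_index in Hk.
    assert (Hk1 := Hle1 k).
    assert (Habs := Rle_abs (IZR z)). assert (Habs' := Rle_abs (- IZR z)).
    rewrite Rabs_Ropp in Habs'. assert (HK0 := pos_INR K).
    assert (Hkz : INR K < INR k + IZR z) by lra.
    assert (Hz : (0 <= Z.of_nat k + z)%Z).
    { apply le_IZR. rewrite plus_IZR, <- INR_IZR_INZ. lra. }
    set (k' := Z.to_nat (Z.of_nat k + z)).
    assert (Ek' : INR k' = INR k + IZR z).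
    { unfold k'. rewrite INR_IZR_INZ, Z2Nat.id, plus_IZR, <- INR_IZR_INZ by easy. easy. }
    destruct (Hex k') as [s' [Hs' Hn]]. unfold near_index in Hn.
    exists s'. split; [easy|].
    assert (H1 := HK k ltac:(apply INR_le; lra)).
    assert (H2 := HK k' ltac:(apply INR_le; lra)).
    apply Rabs_def1; lra.
  - intros H. apply NNPP. intros Hni.
    destruct (base_Int_part m) as [Hz1 Hz2]. set (z := Int_part m) in *.
    assert (Hne : m <> IZR z) by (intros E; apply Hni; now exists z).
    (* The distance from [m] to the integers. The offsets of [s] and [s'] from integers and the
       error in the hypothesis are each made smaller than [d / 3]. *)
    set (d := Rmin (m - IZR z) (IZR z + 1 - m)).
    assert (Hd : 0 < d) by (apply Rmin_glb_lt; lra).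
    assert (Hd1 : d <= m - IZR z) by apply Rmin_l.
    assert (Hd2 : d <= IZR z + 1 - m) by apply Rmin_r.
    destruct (H (d / 3) ltac:(lra)) as [X HX].
    destruct (Hsmall (d / 3) ltac:(lra)) as [K HK].
    assert (HK0 := pos_INR K). assert (Hm0 := Rabs_pos m). assert (HX0 := Rabs_pos X).
    destruct (floor_multiple (INR K + Rabs m + Rabs X + 3) 1) as [k Hk]; [lra|lra|].
    assert (Hm1 := Rle_abs (- m)). rewrite Rabs_Ropp in Hm1. assert (HX1 := Rle_abs X).
    destruct (Hex k) as [s [Hs Hn]]. unfold near_index in Hn.
    destruct (HX s Hs ltac:(lra)) as [s' [Hs' Hdist]].
    destruct (Hnear s' Hs') as [k' Hn']. unfold near_index in Hn'.
    apply Rabs_def2 in Hdist. assert (Hk1' := Hle1 k').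
    assert (H1 := HK k ltac:(apply INR_le; lra)).
    assert (H2 := HK k' ltac:(apply INR_le; lra)).
    rewrite !INR_IZR_INZ in *.
    destruct (Z_lt_le_dec z (Z.of_nat k' - Z.of_nat k)) as [Hlt|Hle].
    + assert (Hlt' : (z + 1 <= Z.of_nat k' - Z.of_nat k)%Z) by lia.
      apply IZR_le in Hlt'. rewrite plus_IZR, minus_IZR in Hlt'. lra.
    + apply IZR_le in Hle. rewrite minus_IZR in Hle. lra.
Qed.

(** * Definability of the integers *)

Lemma F_log_derivative alpha x : 1 < alpha -> 0 < x ->
  x * d_xlogder (F alpha) x = geo_sum alpha x.
Proof.
  intros Ha Hx.
  assert (Hpos : forall n, 0 < alpha ^ S n) by (intros n; apply pow_lt; lra).
  rewrite (d_xlogder_canonical (fun n => alpha ^ S n) 0 Hpos) with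
    (factor := fun t n => 1 + / alpha ^ n * t).
  - unfold geo_sum. simpl pow at 1. ring.
  - apply (ex_series_ext (fun n => / alpha ^ S n)).
    + intros n. simpl. now rewrite Rmult_1_r.
    + now apply ex_series_geo_S.
  - easy.
  - intros t n Ht. unfold log_factor. rewrite sum_n_m_zero by lia.
    unfold zero; cbn -[pow]. rewrite Rplus_0_r, exp_ln.
    + unfold Rdiv. now rewrite Rmult_comm.
    + assert (0 < t / alpha ^ S n) by (apply Rdiv_lt_0_compat; auto). lra.
  - easy.
Qed.

Lemma W_log_derivative beta p x :
  0 < beta -> Int_part (1 / beta) = Z.of_nat p -> 1 < beta * INR (S p) -> 0 < x ->
  x * d_xlogder (W beta) x = (-1) ^ p * csum beta (kern p) x.
Proof.
  intros Hb Hp Hp' Hx.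
  apply (d_xlogder_canonical (power_seq beta) p (power_seq_pos beta)
    (ex_series_inv_pow beta p Hp') (W beta)
    (fun t n => (1 + t / Rpower (INR n) beta) *
      exp (sum_n_m (fun j => (-1) ^ j * t ^ j / (INR j * Rpower (INR n) (beta * INR j)))
             1 (Z.to_nat (Int_part (1 / beta)))))).
  - easy.
  - intros t n Ht. rewrite Hp, Nat2Z.id. unfold log_factor. rewrite exp_plus.
    assert (0 < t / power_seq beta n) by (apply div_power_seq_pos; lra).
    rewrite exp_ln by lra. f_equal. f_equal. apply sum_n_m_ext_loc. intros j Hj.
    assert (Hjp : 0 < INR j) by (apply lt_0_INR; lia).
    rewrite <- Rpower_pow_mult. fold (power_seq beta n).
    assert (Ha := power_seq_pos beta n).
    assert (0 < power_seq beta n ^ j) by now apply pow_lt.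
    match goal with |- ?y = ?z => change (y = z :> R) end.
    unfold Rdiv. rewrite Rpow_mult_distr, pow_inv. field. lra.
  - easy.
Qed.

Lemma dfn_fun_inv {I} (M : I -> R -> R -> Prop) tau :
  dfn_fun M tau -> dfn_fun M (fun e => / tau e).
Proof.
  apply dfn_fun_comp1.
  (* The second disjunct is the convention that the inverse of [0] is [0]. *)
  apply (dfn_ext M (fun e => (~ e 1%nat = 0 /\ e O * e 1%nat = 1) \/ (e 1%nat = 0 /\ e O = 0))).
  - intros e. split.
    + intros [[H1 H2]|[H1 H2]].
      * apply (Rmult_eq_reg_r (e 1%nat)); [|easy]. rewrite Rinv_l; easy.
      * now rewrite H1, Rinv_0.
    + intros ->. destruct (Req_dec (e 1%nat) 0) as [H|H].
      * right. now rewrite H, Rinv_0.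
      * left. split; [easy|]. now rewrite Rinv_l.
  - definability.
Qed.

Lemma dfn_fun_div {I} (M : I -> R -> R -> Prop) tau1 tau2 :
  dfn_fun M tau1 -> dfn_fun M tau2 -> dfn_fun M (fun e => tau1 e / tau2 e).
Proof. intros H1 H2. now apply dfn_fun_mul, dfn_fun_inv. Qed.

Lemma dfn_tends_to {I} (M : I -> R -> R -> Prop) (f : R -> (nat -> R) -> R) tau :
  dfn_fun M (fun e => f (e O) (fun i => e (S i))) -> dfn_fun M tau ->
  dfn M (fun e => tends_to (fun x => f x e) (tau e)).
Proof.
  intros Hf Ht. unfold tends_to. definability.
  (* Position [0] holds the value and position [1] the argument; the parameters move past two more
     bound variables, the threshold [X] and the tolerance. *)
  - exact (dfn_rename M _ (fun i => match i with
      | O => O | 1%nat => 1%nat | S (S i) => S (S (S (S i))) end) Hf).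
  - exact (dfn_fun_weaken M _ (dfn_fun_weaken M _ (dfn_fun_weaken M _ Ht))).
Qed.

(** The increments telescope along [x], [a x], [a^2 x], and so on; a negative [m] reduces to [- m]
    by replacing [x] with [a^m x]. *)
Lemma tends_to_iterate (f : R -> R) (a l : R) (m : Z) :
  1 < a -> tends_to (fun x => f (a * x) - f x) l ->
  tends_to (fun x => f (exp (IZR m * ln a) * x) - f x) (IZR m * l).
Proof.
  intros Ha H.
  assert (Hnat : forall n : nat, tends_to (fun x => f (exp (INR n * ln a) * x) - f x) (INR n * l)).
  { induction n as [|n IH].
    - intros eps Heps. exists 1. split; [lra|]. intros x Hx. simpl.
      rewrite !Rmult_0_l, exp_0, Rmult_1_l, !Rminus_diag, Rabs_R0. exact Heps.
    - assert (Hd := tends_to_dilate (exp (INR n * ln a)) _ _ (exp_pos _) H).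
      apply (tends_to_ext (fun x => (f (a * (exp (INR n * ln a) * x)) - f (exp (INR n * ln a) * x))
        + (f (exp (INR n * ln a) * x) - f x))).
      + intros x Hx.
        replace (exp (INR (S n) * ln a) * x) with (a * (exp (INR n * ln a) * x)); [ring|].
        rewrite S_INR, Rmult_plus_distr_r, Rmult_1_l, exp_plus, exp_ln by lra. ring.
      + rewrite S_INR. replace ((INR n + 1) * l) with (l + INR n * l) by ring.
        now apply tends_to_plus. }
  destruct (Z_lt_le_dec m 0) as [Hm|Hm].
  - specialize (Hnat (Z.to_nat (- m))).
    rewrite INR_IZR_INZ, Z2Nat.id, opp_IZR in Hnat by lia.
    apply (tends_to_dilate (exp (IZR m * ln a)) _ _ (exp_pos _)), (tends_to_scal (-1)) in Hnat.
    replace (IZR m * l) with (-1 * (- IZR m * l)) by ring.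
    revert Hnat. apply tends_to_ext. intros x Hx.
    rewrite <- Rmult_assoc, <- exp_plus.
    replace (- IZR m * ln a + IZR m * ln a) with 0 by ring.
    rewrite exp_0, Rmult_1_l. ring.
  - specialize (Hnat (Z.to_nat m)). now rewrite INR_IZR_INZ, Z2Nat.id in Hnat.
Qed.

(* [f] acts as a logarithm on [a^Z], since [f (a^m x) - f x -> m l]. *)
Lemma definable_integers_log {I} (M : I -> R -> R -> Prop) (E : R -> Prop) (f : R -> R) (a l : R) :
  dfn M (fun e => E (e O)) ->
  (forall tau, dfn_fun M tau -> dfn_fun M (fun e => f (tau e))) ->
  1 < a -> (forall c, E c <-> exists m : Z, c = exp (IZR m * ln a)) ->
  l <> 0 -> tends_to (fun x => f (a * x) - f x) l ->
  definable M is_integer.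
Proof.
  intros HE Hf Ha HEa Hl Hlim. apply dfn_definable.
  apply (dfn_ext M (fun e => exists c, E c /\ tends_to (fun x => f (c * x) - f x) (e O * l))).
  - intros e. split.
    + intros [c [Hc Hlc]]. apply HEa in Hc. destruct Hc as [m ->]. exists m.
      apply (Rmult_eq_reg_r l); [|easy].
      eapply tends_to_unique; [exact Hlc|]. now apply tends_to_iterate.
    + intros [m Hm]. exists (exp (IZR m * ln a)). split.
      * apply HEa. now exists m.
      * rewrite Hm. now apply tends_to_iterate.
  - apply (dfn_ex M (fun c e => E c /\ tends_to (fun x => f (c * x) - f x) (e O * l))).
    apply dfn_and.
    + apply (dfn_comp1 M E _ HE), dfn_fun_var.
    + apply (dfn_tends_to M (fun x e => f (e O * x) - f x) (fun e => e 1%nat * l));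
        repeat (definability_step || apply Hf).
Qed.

(* [V] enumerates a dense sequence over the discrete set [a^N]; the integers are
   then read off with the two parameters of [coding]. *)
Lemma definable_integers_dense {I} (M : I -> R -> R -> Prop) (V : R -> R -> Prop)
    (a A B : R) (w : nat -> R) :
  dfn M (fun e => V (e O) (e 1%nat)) -> 1 < a ->
  (forall d v, V d v <-> exists n : nat, d = exp (INR n * ln a) /\ v = w n) ->
  (forall n, A <= w n < B) ->
  (forall l r, A <= l -> l < r -> r <= B -> exists n, l < w n < r) ->
  definable M is_integer.
Proof.
  intros HV Ha HVw Hw Hdense.
  destruct (coding w A B Hw Hdense) as [c1 [c2 [Hc Hc']]].
  (* [rec] and [gap] below are [low_record] and [gap_ratio] with the index [n] replaced by [a^n]:
     only the order of the indices matters. *)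
  set (rec := fun d => exists v, V d v /\ v < c1 /\
    forall d' v', V d' v' -> d' < d -> v' < c1 -> v' < v).
  set (gap := fun d s => exists p q, (exists d', V d' p /\ d' <= d) /\
    (exists d', V d' q /\ d' <= d) /\ p < c2 /\ c2 < q /\
    (forall d' v', V d' v' -> d' <= d -> v' <= p \/ q <= v') /\ s * (c2 - p) = q - p).
  set (P := fun s => exists d, rec d /\ gap d s).
  assert (Hln : 0 < ln a) by (rewrite <- ln_1; apply ln_increasing; lra).
  assert (Hlt : forall i j, exp (INR i * ln a) < exp (INR j * ln a) <-> (i < j)%nat).
  { intros i j. split; intros H.
    - apply exp_lt_inv in H. apply INR_lt. nra.
    - apply exp_increasing. apply lt_INR in H. nra. }
  assert (Hle : forall i j, exp (INR i * ln a) <= exp (INR j * ln a) <-> (i <= j)%nat).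
  { intros i j. specialize (Hlt j i). split; intros H.
    - apply Nat.nlt_ge. intros H'. apply Hlt in H'. lra.
    - apply Rnot_lt_le. intros H'. apply Hlt in H'. lia. }
  assert (HVn : forall n, V (exp (INR n * ln a)) (w n)) by (intros n; apply HVw; now exists n).
  assert (Hinj : forall n v, V (exp (INR n * ln a)) v -> v = w n).
  { intros n v Hv. apply HVw in Hv. destruct Hv as [m [Hm ->]]. f_equal.
    apply Nat.le_antisymm; apply Hle; lra. }
  assert (Hrec : forall n, rec (exp (INR n * ln a)) <-> low_record w c1 n).
  { intros n. split.
    - intros [v [Hv [Hvc Hmax]]]. apply Hinj in Hv. subst v. split; [easy|].
      intros i Hi Hwi. apply (Hmax (exp (INR i * ln a))); auto. now apply Hlt.
    - intros [H1 H2]. exists (w n). split; [easy|]. split; [easy|].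
      intros d' v' HV' Hd' Hv'. apply HVw in HV'. destruct HV' as [i [-> ->]].
      apply H2; [now apply Hlt|easy]. }
  assert (Hgap : forall n s, gap (exp (INR n * ln a)) s <-> gap_ratio w c2 n s).
  { intros n s. split.
    - intros (p & q & [d [Hd Hdn]] & [d' [Hd' Hdn']] & H1 & H2 & H3 & H4).
      apply HVw in Hd. destruct Hd as [i [-> ->]].
      apply HVw in Hd'. destruct Hd' as [j [-> ->]].
      exists (w i), (w j). repeat split; auto.
      + exists i. split; [now apply Hle|easy].
      + exists j. split; [now apply Hle|easy].
      + intros k Hk. apply (H3 (exp (INR k * ln a))); [easy|now apply Hle].
    - intros (p & q & [i [Hi <-]] & [j [Hj <-]] & H1 & H2 & H3 & H4).
      exists (w i), (w j). repeat split; auto.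
      + exists (exp (INR i * ln a)). split; [easy|now apply Hle].
      + exists (exp (INR j * ln a)). split; [easy|now apply Hle].
      + intros d' v' HV' Hd'. apply HVw in HV'. destruct HV' as [k [-> ->]].
        apply H3. now apply Hle. }
  apply dfn_definable.
  apply (dfn_ext M (fun e => forall eps, 0 < eps -> exists X, forall s, P s -> X < s ->
      exists s', P s' /\ Rabs (s' - s - e O) < eps)).
  - intros e. symmetry. apply (integer_difference_set P).
    + intros s [d [Hr Hg]].
      assert (Hd : exists n : nat, d = exp (INR n * ln a)).
      { destruct Hr as [v [Hv _]]. apply HVw in Hv. destruct Hv as [n [-> _]]. now exists n. }
      destruct Hd as [n ->]. apply (Hc n); [now apply Hrec|now apply Hgap].
    + intros k. destruct (Hc' k) as (j & s & H1 & H2 & H3). exists s. split; [|easy].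
      exists (exp (INR j * ln a)). split; [now apply Hrec|now apply Hgap].
  - assert (HP : dfn M (fun e => P (e O))).
    { unfold P, rec, gap.
      repeat (definability_step || apply (dfn_comp2 M V _ _ HV)). }
    repeat (definability_step || apply (dfn_comp1 M P _ HP)).
Qed.

Lemma irrational_inv beta :
  0 < beta -> ~ (exists q : Q, beta = Q2R q) ->
  forall i j : Z, IZR j * (1 / beta) = IZR i -> j = 0%Z.
Proof.
  intros Hb Hirr i j H. apply NNPP. intros Hj. apply Hirr.
  assert (Hji : IZR j = IZR i * beta) by (rewrite <- H; field; lra).
  assert (Hi : i <> 0%Z).
  { intros ->. apply Hj, eq_IZR. lra. }
  exists (inject_Z j / inject_Z i)%Q.
  assert (HiR : IZR i <> 0) by (intros E; now apply Hi, eq_IZR).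
  assert (E : forall z, Q2R (inject_Z z) = IZR z).
  { intros z. unfold Q2R, inject_Z; simpl. field. }
  rewrite Q2R_div, !E, Hji; [field; easy|].
  intros E'. apply Hi. unfold Qeq in E'. simpl in E'. lia.
Qed.

Lemma tends_to_power (f : R -> R) (rho L y : R) :
  0 < L -> 0 < y -> tends_to (fun x => f x / Rpower x rho) L ->
  tends_to (fun x => f (y * x) / f x) (Rpower y rho).
Proof.
  intros HL Hy H.
  replace (Rpower y rho) with (Rpower y rho * (L / L)) by (field; lra).
  apply (tends_to_ext (fun x => Rpower y rho *
    ((f (y * x) / Rpower (y * x) rho) / (f x / Rpower x rho)))).
  - intros x Hx. rewrite <- Rpower_mult_distr by easy.
    assert (H1 : 0 < Rpower y rho) by apply exp_pos.
    assert (H2 : 0 < Rpower x rho) by apply exp_pos.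
    (* Where [f x = 0], the quotients by it are [0] on both sides, by the convention on inverses. *)
    destruct (Req_dec (f x) 0) as [E|E].
    + rewrite E. unfold Rdiv. rewrite Rmult_0_l, Rinv_0. ring.
    + field. lra.
  - apply tends_to_scal, tends_to_div; [lra| |easy].
    apply (tends_to_dilate y (fun x => f x / Rpower x rho)); easy.
Qed.

Theorem mainTheorem8 (alpha beta : R) (halpha : 1 < alpha) (hbeta : 0 < beta)
    (hcase : (exists k : nat, 1 / beta = INR k) \/
             ~ (exists q : Q, beta = Q2R q)) :
  definable (pair_rel (graph_pos (d_xlogder (F alpha)))
                      (graph_pos (d_xlogder (W beta))))
            is_integer.
Proof.
  set (St := pair_rel _ _).
  set (f := fun x => x * on_pos (d_xlogder (F alpha)) x).
  set (g := fun x => x * on_pos (d_xlogder (W beta)) x).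
  assert (Hf : forall tau, dfn_fun St tau -> dfn_fun St (fun e => f (tau e))).
  { intros tau Ht. apply dfn_fun_mul; [easy|].
    now apply (dfn_fun_on_pos St true). }
  assert (Hg : forall tau, dfn_fun St tau -> dfn_fun St (fun e => g (tau e))).
  { intros tau Ht. apply dfn_fun_mul; [easy|].
    now apply (dfn_fun_on_pos St false). }
  assert (Hfx : forall x, 0 < x -> f x = geo_sum alpha x).
  { intros x Hx. unfold f. rewrite on_pos_pos by easy. now apply F_log_derivative. }
  set (E := fun c => 0 < c /\ tends_to (fun x => f (c * x) - f x) 0).
  assert (HE : dfn St (fun e => E (e O))).
  { apply dfn_and; [definability|].
    apply (dfn_tends_to St (fun x e => f (e O * x) - f x) (fun _ => 0));
      repeat (definability_step || apply Hf). }
  destruct (periods_cyclic alpha halpha) as [a [Ha Hper]].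
  assert (HEa : forall c, E c <-> exists m : Z, c = exp (IZR m * ln a)).
  { intros c. rewrite <- Hper. unfold E, is_period.
    split; intros [Hc H]; (split; [easy|]); revert H; apply tends_to_ext; intros x Hx;
      rewrite !Hfx by nra; easy. }
  destruct hcase as [[k Hk]|Hirr].
  - destruct k as [|k].
    { exfalso. assert (0 < 1 / beta) by (apply Rdiv_lt_0_compat; lra). simpl in Hk. lra. }
    assert (Hbk : beta * INR (S k) = 1) by (rewrite <- Hk; field; lra).
    assert (Hgx : forall x, 0 < x -> g x = (-1) ^ S k * csum beta (kern (S k)) x).
    { intros x Hx. unfold g. rewrite on_pos_pos by easy. apply W_log_derivative; auto.
      - rewrite Hk. apply Int_part_INR.
      - rewrite (S_INR (S k)). nra. }
    destruct (csum_kern_increment_limit beta hbeta k a Hbk Ha) as [L [HL Hlim]].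
    apply (definable_integers_log St E (fun x => g x / x ^ S k) a ((-1) ^ S k * L)); auto.
    + intros tau Ht. apply dfn_fun_div; [now apply Hg|now apply dfn_fun_pow].
    + apply Rmult_integral_contrapositive. split; [apply pow_nonzero; lra|lra].
    + apply (tends_to_scal ((-1) ^ S k)) in Hlim. revert Hlim.
      apply tends_to_ext. intros x Hx. rewrite !Hgx by nra. unfold Rdiv. ring.
  - set (rho := 1 / beta) in *.
    assert (Hrho : 0 < rho) by (apply Rdiv_lt_0_compat; lra).
    assert (Hbr : beta * rho = 1) by (unfold rho; field; lra).
    assert (Hq := irrational_inv beta hbeta Hirr). fold rho in Hq.
    destruct (base_Int_part rho) as [Hi1 Hi2].
    assert (Hi0 : (0 <= Int_part rho)%Z).
    { cut (0 < Int_part rho + 1)%Z; [lia|]. apply lt_IZR. rewrite plus_IZR. lra. }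
    set (p := Z.to_nat (Int_part rho)).
    assert (Hp : Int_part rho = Z.of_nat p) by (unfold p; rewrite Z2Nat.id; easy).
    rewrite Hp, <- INR_IZR_INZ in Hi1, Hi2.
    (* Irrationality makes the inequality strict, which keeps away from the borderline case with its
       logarithm. *)
    assert (Hi1' : INR p < rho).
    { destruct Hi1 as [H|H]; [easy|]. exfalso.
      assert (1 = 0)%Z; [|easy]. apply (Hq (Z.of_nat p)).
      rewrite Rmult_1_l, <- H. apply INR_IZR_INZ. }
    assert (Hb1 : beta * INR p < 1) by (rewrite <- Hbr; now apply Rmult_lt_compat_l).
    assert (Hb2 : 1 < beta * INR (S p)).
    { rewrite <- Hbr, S_INR. apply Rmult_lt_compat_l; lra. }
    assert (Hgx : forall x, 0 < x -> g x = (-1) ^ p * csum beta (kern p) x).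
    { intros x Hx. unfold g. rewrite on_pos_pos by easy. now apply W_log_derivative. }
    destruct (csum_kern_limit beta hbeta p Hb1 Hb2) as [L [HL Hlim]]. fold rho in Hlim.
    (* The graph of [y -> y ^ rho]: the unknown constant [L] and the sign [(-1) ^ p] cancel in the
       quotient. *)
    set (Pw := fun y z => 0 < y /\ tends_to (fun x => g (y * x) / g x) z).
    assert (HPw : forall y z, 0 < y -> Pw y z <-> z = exp (rho * ln y)).
    { intros y z Hy.
      assert (Hlim' : tends_to (fun x => g (y * x) / g x) (Rpower y rho)).
      { generalize (tends_to_power _ _ _ y HL Hy Hlim). apply tends_to_ext.
        intros x Hx. rewrite !Hgx by nra.
        assert (Hsq : (-1) ^ p <> 0) by (apply pow_nonzero; lra).
        unfold Rdiv. rewrite Rinv_mult.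
        transitivity (((-1) ^ p * / (-1) ^ p) * (csum beta (kern p) (y * x) * / csum beta (kern p) x)).
        - rewrite Rinv_r by easy. ring.
        - ring. }
      unfold Pw. split.
      - intros [_ H]. now apply (tends_to_unique _ _ _ H).
      - intros ->. now split. }
    (* [v] is the representative in [[1, a)] of [d ^ rho] modulo the group [E]; the condition
       [1 <= d] keeps the nonnegative exponents. *)
    set (V := fun d v => E d /\ 1 <= d /\ 1 <= v /\ v < a /\ exists c, E c /\ Pw d (v * c)).
    assert (Hln : 0 < ln a) by (rewrite <- ln_1; apply ln_increasing; lra).
    set (w := fun n => exp (frac_part (INR n * rho) * ln a)).
    assert (Hwb : forall n, 1 <= w n < a).
    { intros n. unfold w. destruct (base_fp (INR n * rho)) as [H1 H2]. split.
      - rewrite <- exp_0. destruct H1 as [H1|H1].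
        + left. apply exp_increasing. nra.
        + rewrite H1, Rmult_0_l. lra.
      - rewrite <- (exp_ln a) at 2 by lra. apply exp_increasing. nra. }
    apply (definable_integers_dense St V a 1 a w); auto.
    + assert (HPwd : dfn St (fun e => Pw (e O) (e 1%nat))).
      { apply dfn_and; [definability|].
        apply (dfn_tends_to St (fun x e => g (e O * x) / g x) (fun e => e 1%nat)).
        - apply dfn_fun_div; repeat (definability_step || apply Hg).
        - definability. }
      unfold V. repeat (definability_step || apply (dfn_comp1 St E _ HE) || apply (dfn_comp2 St Pw _ _ HPwd)).
    + intros d v. split.
      * intros (Hd & Hd1 & Hv1 & Hva & c & Hc & HP).
        apply HEa in Hd. destruct Hd as [m Hm]. apply HEa in Hc. destruct Hc as [j Hj].
        apply HPw in HP; [|lra].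
        assert (Hm0 : (0 <= m)%Z).
        { apply le_IZR. apply Rnot_lt_le. intros Hlt.
          assert (d < 1); [|lra]. rewrite Hm, <- exp_0. apply exp_increasing. nra. }
        exists (Z.to_nat m). rewrite INR_IZR_INZ, Z2Nat.id by easy. split; [easy|].
        assert (Hv : v = exp ((IZR m * rho - IZR j) * ln a)).
        { apply (Rmult_eq_reg_r c); [|rewrite Hj; apply Rgt_not_eq, exp_pos].
          rewrite HP, Hm, ln_exp, Hj, <- exp_plus. f_equal. ring. }
        unfold w. rewrite INR_IZR_INZ, Z2Nat.id by easy.
        rewrite (frac_part_eq (IZR m * rho) j (IZR m * rho - IZR j)); [easy| |ring].
        split.
        -- apply Rnot_lt_le. intros Hlt. assert (v < 1); [|lra].
           rewrite Hv, <- exp_0. apply exp_increasing. nra.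
        -- apply Rnot_le_lt. intros Hle. assert (a <= v); [|lra].
           rewrite Hv, <- (exp_ln a) at 1 by lra.
           destruct (Req_dec (IZR m * rho - IZR j) 1) as [->|Hne].
           ++ rewrite Rmult_1_l. lra.
           ++ left. apply exp_increasing. nra.
      * intros [n [-> ->]]. assert (Hw := Hwb n).
        split; [apply HEa; exists (Z.of_nat n); now rewrite INR_IZR_INZ|].
        split; [|split; [lra|split; [lra|]]].
        { rewrite <- exp_0. assert (Hn := pos_INR n). destruct Hn as [Hn|Hn].
          - left. apply exp_increasing. nra.
          - rewrite <- Hn, Rmult_0_l. lra. }
        exists (exp (IZR (Int_part (INR n * rho)) * ln a)). split.
        { apply HEa. now exists (Int_part (INR n * rho)). }
        apply HPw; [apply exp_pos|]. unfold w. rewrite ln_exp, <- exp_plus. f_equal.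
        rewrite <- Rmult_plus_distr_r, Rplus_comm, <- Rplus_Int_part_frac_part. ring.
    + intros l r Hl Hlr Hr.
      destruct (frac_part_multiples_dense rho (ln l / ln a) (ln r / ln a)) as [n Hn].
      * exact Hq.
      * apply Rdiv_le_0_compat; [|easy]. rewrite <- ln_1. apply ln_le; lra.
      * apply Rmult_lt_compat_r; [now apply Rinv_0_lt_compat|]. apply ln_increasing; lra.
      * apply (Rmult_le_reg_r (ln a)); [easy|]. unfold Rdiv.
        rewrite Rmult_assoc, Rinv_l, Rmult_1_l, Rmult_1_r by lra. apply ln_le; lra.
      * exists n. unfold w.
        assert (E1 : ln l / ln a * ln a = ln l) by (field; lra).
        assert (E2 : ln r / ln a * ln a = ln r) by (field; lra).
        rewrite <- (exp_ln l), <- (exp_ln r) by lra.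
        split; apply exp_increasing; nra.
Qed.
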